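(* Let $q$ be a prime power, $\chi$ a multiplicative character of $\mathbb{F}_{q^2}^*$ and $\lambda$ a nontrivial additive character of $\mathbb{F}_{q^2}$. Then, as formal power series in $u$, \[ 1+\sum_{n=1}^\infty\frac{u^n}{|U(n,q)|}\sum_{g\in U(n,q)}\chi(\det g)\,\lambda(\operatorname{tr} g) = \prod_{i\ge1}\left(1+(-1)^{i+1}\frac{u\,G_1(\chi,\lambda)}{q^i}+\frac{u^2G_2(\chi,\lambda)}{q^{2i}}\right). \]
   Context: $U(n,q)\subset GL(n,q^2)$ is the finite unitary group, i.e. the group of $n\times n$ matrices $g$ over $\mathbb{F}_{q^2}$ preserving a nondegenerate Hermitian form (e.g. $\bar g^{T}g=I$, where $\bar g$ applies $a\mapsto a^q$ entrywise). Set $\chi(0)=0$. Define $G_1(\chi,\lambda)=\sum_{\alpha\in\mathbb{F}_{q^2},\,\alpha^{q+1}=1}\chi(-\alpha)\lambda(-\alpha)$ and $G_2(\chi,\lambda)=\sum_{\alpha\in\mathbb{F}_{q^2},\,\alpha^{q+1}=1}\chi(\alpha)\sum_{\beta\in\mathbb{F}_{q^2}:\ \beta^{q-1}=\alpha^q\text{ or }\beta=0}\lambda(-\beta)$. *)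

(* Defs.v *)
From HB Require Import structures.
From mathcomp Require Import all_boot all_order all_algebra all_field.
From mathcomp Require Import complex.
From mathcomp Require Import all_classical all_reals all_analysis.
Set Implicit Arguments. Unset Strict Implicit. Unset Printing Implicit Defensive.
Import Order.TTheory GRing.Theory Num.Theory.
Import numFieldNormedType.Exports.
Local Open Scope ring_scope.

Section Defs.
Variables (F : finFieldType) (q : nat) (C : fieldType).

Definition qconj (a : F) : F := a ^+ q.

Definition unitary_group (n : nat) : {set 'M[F]_n} :=
  [set g : 'M[F]_n | (map_mx qconj g)^T *m g == 1%:M].

Definition mult_char (chi : F -> C) : Prop :=
  [/\ chi 0 = 0, chi 1 = 1 & forall x y, x != 0 -> y != 0 -> chi (x * y) = chi x * chi y].

Definition add_char (lam : F -> C) : Prop :=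
  lam 0 = 1 /\ forall x y, lam (x + y) = lam x * lam y.

Definition G1 (chi lam : F -> C) : C :=
  \sum_(a : F | a ^+ q.+1 == 1) chi (- a) * lam (- a).

Definition G2 (chi lam : F -> C) : C :=
  \sum_(a : F | a ^+ q.+1 == 1)
     chi a * \sum_(b : F | (b ^+ (q - 1) == a ^+ q) || (b == 0)) lam (- b).

Definition lhs_coeff (chi lam : F -> C) (n : nat) : C :=
  if n is 0 then 1 else
  (#|unitary_group n|%:R)^-1 *
    \sum_(g in unitary_group n) chi (\det g) * lam (\tr g).

Definition rhs_factor (chi lam : F -> C) (i : nat) : {poly C} :=
  1 + (((-1) ^+ i.+1 * G1 chi lam) / (q%:R ^+ i)) *: 'X
    + (G2 chi lam / (q%:R ^+ (2 * i))) *: 'X^2.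

End Defs.

Definition prime_power (q : nat) : Prop :=
  exists p k, [/\ prime p, (0 < k)%N & q = (p ^ k)%N].

(* Main.v *)
Require Import Defs.
From HB Require Import structures.
From mathcomp Require Import all_boot all_order all_algebra all_field.
From mathcomp Require Import complex.
From mathcomp Require Import all_classical all_reals all_analysis.
From mathcomp Require Import ring.
Import Order.TTheory GRing.Theory Num.Theory.
Import numFieldNormedType.Exports.

(* Put [Q = - q], let [S n] be the sum over U(n,q) of [chi (\det g) * lam (\tr g)] and
   [E n = S n / #|U(n,q)|].  With [P(t) = 1 + G1 t + G2 t^2] the infinite product is the
   product over [i >= 1] of [P(- u / Q^i)], so the theorem amounts to the functional
   equation [E(Q u) = P(- u) E(u)], that is
     (Q^(n+2) - 1) E_(n+2) = G2 E_n - G1 E_(n+1).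
   The recursion is proved without the classification of conjugacy classes.  For the unit
   vector [e], [f_m(k)] is the sum over U(m+1,q) with the diagonal entry [<e, g e>]
   multiplied by [k] in the trace.  Sorting the [g] by [x = g e] and writing them as a
   quasi-reflection [e |-> x] times an element of U(m,q), the inner sum only depends on
   [c = <e, x>]: it is [f_(m-1)(conj c)] if [|c| <> 1], while for [|c| = 1] there appear sums
   twisted by an isotropic vector [z = x - c e].  The latter differ from [S m] by an explicit
   multiple of [G2 * S (m-2)], because the [g] with [<z, g z> <> 0] form a big Bruhat cell on
   which everything is a Gauss sum.  Finally the transform
   [phi |-> (k |-> \sum_c lam (k * c) * phi (conj c))] relating [f_m] to [f_(m-1)] squares to
   [q * G2] on the functions at hand, which closes the recursion. *)

Set Implicit Arguments. Unset Strict Implicit. Unset Printing Implicit Defensive.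
Local Open Scope ring_scope.

(** * The quadratic extension *)

Section QuadraticExtension.
Variables (F : finFieldType) (q : nat) (bar : {rmorphism F -> F}).
Hypotheses (q_gt1 : (1 < q)%N) (cardF : #|F| = (q ^ 2)%N).
Hypothesis barE : forall x, bar x = x ^+ q.

Lemma barK : involutive bar.
Proof. by move=> x; rewrite !barE -exprM -[(q * q)%N]/(q ^ 2)%N -cardF expf_card. Qed.

Lemma card_roots_le (p : {poly F}) (P : pred F) :
  p != 0 -> (forall x, P x -> root p x) -> (#|P| < size p)%N.
Proof.
move=> p0 h; rewrite cardE; apply: max_poly_roots => //; last exact: enum_uniq.
by apply/allP => x; rewrite mem_enum => /h.
Qed.

Lemma card_fix_le : (#|[pred x : F | (bar x == x)%R]| <= q)%N.
Proof.
have hs : size ('X^q - 'X : {poly F})%R = q.+1.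
  by rewrite size_polyDl size_polyXn // size_polyN size_polyX.
rewrite -ltnS -hs; apply: card_roots_le.
  by rewrite -size_poly_eq0 hs.
by move=> x /= /eqP hx; rewrite rootE !hornerE -barE hx subrr.
Qed.

Lemma card_trace0_le : (#|[pred x : F | (x + bar x == 0)%R]| <= q)%N.
Proof.
have hs : size ('X^q + 'X : {poly F})%R = q.+1.
  by rewrite size_polyDl size_polyXn // size_polyX.
rewrite -ltnS -hs; apply: card_roots_le.
  by rewrite -size_poly_eq0 hs.
by move=> x /= /eqP hx; rewrite rootE !hornerE -barE addrC hx.
Qed.

Lemma card_norm_le (r : F) : (#|[pred x : F | (x * bar x == r)%R]| <= q.+1)%N.
Proof.
have hs : size ('X^(q.+1) - r%:P : {poly F})%R = q.+2.
  by rewrite size_polyDl size_polyXn // size_polyN (leq_ltn_trans (size_polyC_leq1 _)).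
rewrite -ltnS -hs; apply: card_roots_le.
  by rewrite -size_poly_eq0 hs.
by move=> x /= /eqP <-; rewrite rootE !hornerE barE exprS subrr.
Qed.

Lemma trace_fix x : bar (x + bar x) = x + bar x.
Proof. by rewrite rmorphD /= barK addrC. Qed.

Lemma norm_fix x : bar (x * bar x) = x * bar x.
Proof. by rewrite rmorphM /= barK mulrC. Qed.

Lemma card_trace_fiber (r : F) :
  (#|[pred x : F | (x + bar x == r)%R]| <= #|[pred x : F | (x + bar x == 0)%R]|)%N.
Proof.
case: (pickP [pred x : F | (x + bar x == r)%R]) => [x0 /= /eqP h0|h]; last by rewrite eq_card0.
rewrite -(fintype.card_image (addrI (- x0))).
apply/subset_leq_card/fintype.subsetP => y /fintype.imageP [x].
rewrite !inE => /eqP hx ->; apply/eqP; rewrite rmorphD rmorphN /= addrACA hx -opprD h0.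
by rewrite addNr.
Qed.

Lemma sum_card_fibers (f : F -> F) (P : pred F) (Q : pred F) :
  (forall x, P x -> Q (f x)) -> #|P| = (\sum_(r | Q r) #|[pred x : F | P x && (f x == r)]|)%N.
Proof.
move=> h; rewrite -sum1_card (partition_big f Q) //=.
by apply: eq_bigr => r _; rewrite sum1_card.
Qed.

(** Double counting: traces are fixed by [bar], and no trace fibre exceeds the kernel, so q^2 is at
    most the product of the two cardinals. Both are at most q by degree. *)
Lemma card_fix_trace0 :
  #|[pred x : F | (bar x == x)%R]| = q /\ #|[pred x : F | (x + bar x == 0)%R]| = q.
Proof.
have h := @sum_card_fibers (fun x => x + bar x) predT [pred x : F | (bar x == x)%R]
  (fun x _ => introT eqP (trace_fix x)).
have {h} : (q * q <= #|[pred x : F | (bar x == x)%R]| * #|[pred x : F | ((x + bar x)%R == 0)%R]|)%N.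
  rewrite -[(q * q)%N]/(q ^ 2)%N -cardF -cardsT cardsE {1}h -sum_nat_const.
  by apply: leq_sum => r _; exact: card_trace_fiber.
have := card_fix_le; have := card_trace0_le; move: #|_| #|_| => a b ha hb hab.
have q0 : (0 < q)%N by apply: ltn_trans q_gt1.
split; apply/eqP; rewrite eqn_leq ?ha ?hb /=.
  by rewrite -(leq_pmul2r q0) (leq_trans hab) // leq_mul2l ha orbT.
by rewrite -(leq_pmul2l q0) (leq_trans hab) // leq_mul2r hb orbT.
Qed.

Lemma card_fix : #|[pred x : F | (bar x == x)%R]| = q.
Proof. by case: card_fix_trace0. Qed.

Lemma card_trace0 : #|[pred x : F | (x + bar x == 0)%R]| = q.
Proof. by case: card_fix_trace0. Qed.

(** Turns the degree bounds on the trace and norm fibres into equalities. *)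
Lemma sum_nat_eq_bound (T : finType) (P : pred T) (f : T -> nat) b :
  (forall x, P x -> f x <= b)%N -> (\sum_(x | P x) f x = #|P| * b)%N ->
  forall x, P x -> f x = b.
Proof.
move=> hle hs x Px; apply/eqP; rewrite eqn_leq hle //= leqNgt; apply/negP => hlt.
have: (\sum_(x | P x) f x < \sum_(x | P x) b)%N.
  rewrite (bigD1 x) //= [X in (_ < X)%N](bigD1 x) //= -addSn leq_add //.
  by apply: leq_sum => y /andP[/hle].
by rewrite hs sum_nat_const ltnn.
Qed.

Lemma card_trace r : bar r = r -> #|[pred x : F | (x + bar x == r)%R]| = q.
Proof.
move=> hr; apply: (@sum_nat_eq_bound F [pred x : F | bar x == x]
  (fun r => #|[pred x : F | (x + bar x == r)%R]|) q _ _ r); last by rewrite /= hr.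
  by move=> x _; rewrite -card_trace0 card_trace_fiber.
rewrite card_fix -[(q * q)%N]/(q ^ 2)%N -cardF -cardsT cardsE.
rewrite (@sum_card_fibers (fun x => x + bar x) predT [pred x : F | (bar x == x)%R]) //.
by move=> x _ /=; rewrite trace_fix.
Qed.

Lemma norm_eq0 x : (x * bar x == 0) = (x == 0).
Proof. by rewrite mulf_eq0 fmorph_eq0 orbb. Qed.

Lemma card_norm r : bar r = r -> r != 0 -> #|[pred x : F | (x * bar x == r)%R]| = q.+1.
Proof.
move=> hr r0; apply: (@sum_nat_eq_bound F [pred x : F | (x != 0) && (bar x == x)]
  (fun r => #|[pred x : F | (x * bar x == r)%R]|) q.+1 _ _ r); last by rewrite /= r0 hr /=.
  by move=> x _; rewrite card_norm_le.
have -> : #|[pred x : F | ((x != 0) && (bar x == x))%R]| = q.-1.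
  have := card_fix; rewrite (cardD1 0) inE rmorph0 eqxx add1n => <- /=.
  by apply: eq_card => x; rewrite !inE.
(* The q - 1 nonzero fixed elements have at most q + 1 preimages each, and together these must
   exhaust the q^2 - 1 nonzero elements of F. *)
have -> : (q.-1 * q.+1 = (q ^ 2).-1)%N.
  by rewrite -mulnn; case: q q_gt1 => // k _; rewrite [in RHS]mulSn addSn; exact: mulnS.
rewrite -cardF.
have -> : #|F|.-1 = #|[pred x : F | (x != 0)%R]|.
  by rewrite -(cardC1 (0 : F)); apply: eq_card => x; rewrite !inE.
rewrite (@sum_card_fibers (fun x => x * bar x) _ [pred x : F | ((x != 0) && (bar x == x))%R]).
  apply: eq_bigr => s /andP[s0 _]; apply: eq_card => x; rewrite !inE.
  case: (x * bar x =P s) => [hs|]; rewrite ?andbF ?andbT //.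
  by move: s0; rewrite -hs norm_eq0 => ->.
by move=> x /= x0; rewrite norm_eq0 x0 norm_fix /=.
Qed.

Lemma exists_norm r : bar r = r -> r != 0 -> exists2 d, d != 0 & d * bar d = r.
Proof.
move=> hr r0; have := card_norm hr r0.
case: (pickP [pred x : F | (x * bar x == r)%R]) => [x /= /eqP hx _|h]; last by rewrite eq_card0.
by exists x => //; rewrite -norm_eq0 hx.
Qed.

Lemma exists_trace r : bar r = r -> exists x, x + bar x = r.
Proof.
move=> hr; have := card_trace hr.
case: (pickP [pred x : F | (x + bar x == r)%R]) => [x /= /eqP hx _|h]; first by exists x.
by rewrite eq_card0 // => h0; move: q_gt1; rewrite -h0.
Qed.

(** Used to rotate a vector out of the position in which [refl_map] does not apply. *)
Lemma exists_norm1_neq c : exists2 a, a * bar a = 1 & a != c.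
Proof.
have := card_norm (rmorph1 bar) (oner_neq0 F).
case: (pickP [pred x : F | ((x * bar x == 1) && (x != c))%R]) => [x /= /andP[/eqP hx xc] _|h].
  by exists x.
have : (#|[pred x : F | (x * bar x == 1%R)%R]| <= #|pred1 c|)%N.
  apply/subset_leq_card/fintype.subsetP => x; rewrite !inE => hx.
  by have := h x; rewrite /= hx /= => /negbFE.
by rewrite card1 => /[swap] ->; rewrite ltnS leqn0 => /eqP h0; move: q_gt1; rewrite h0.
Qed.


(** * Characters and Gauss sums *)

Variables (C : numFieldType) (chi lam : F -> C).
Hypotheses (lam0 : lam 0 = 1) (lamD : forall x y, lam (x + y) = lam x * lam y).
Hypothesis lam_nontriv : exists x, lam x != 1.
Hypotheses (chi0 : chi 0 = 0) (chi1 : chi 1 = 1).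
Hypothesis chiM_unit : forall x y : F, x != 0 -> y != 0 -> chi (x * y) = chi x * chi y.

Lemma chiM x y : chi (x * y) = chi x * chi y.
Proof.
have [->|x0] := eqVneq x 0; first by rewrite mul0r chi0 mul0r.
have [->|y0] := eqVneq y 0; first by rewrite mulr0 chi0 mulr0.
exact: chiM_unit.
Qed.

Lemma chiK x : x != 0 -> chi x * chi x^-1 = 1.
Proof. by move=> x0; rewrite -chiM divff. Qed.

Lemma chi_neq0 x : x != 0 -> chi x != 0.
Proof. by move=> /chiK; apply: contra_eq_neq => ->; rewrite mul0r eq_sym oner_neq0. Qed.

Lemma chiV x : chi x^-1 = (chi x)^-1.
Proof.
have [->|x0] := eqVneq x 0; first by rewrite invr0 chi0 invr0.
by apply: (mulfI (chi_neq0 x0)); rewrite chiK // divff // chi_neq0.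
Qed.

(** Translation by x0 permutes A, hence preserves the sum, but it also multiplies it by [f x0]. *)
Lemma sum_char_eq0 (A : pred F) (f : F -> C) x0 :
  (forall x y, f (x + y) = f x * f y) -> f x0 != 1 ->
  (forall y, A (x0 + y) = A y) -> \sum_(y | A y) f y = 0.
Proof.
move=> fD f0 hA; have : (1 - f x0) * \sum_(y | A y) f y = 0.
  rewrite mulrBl mul1r big_distrr /= (reindex_inj (addrI x0)) /=.
  by under eq_bigl do rewrite hA; under eq_bigr do rewrite fD; rewrite subrr.
by move/eqP; rewrite mulf_eq0 subr_eq0 eq_sym (negPf f0) => /eqP.
Qed.

Lemma lam_scaleD a x y : lam (a * (x + y)) = lam (a * x) * lam (a * y).
Proof. by rewrite mulrDr lamD. Qed.

Lemma sum_lam a : \sum_x lam (a * x) = if a == 0 then (q ^ 2)%:R else 0.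
Proof.
have [->|a0] := eqVneq a 0.
  under eq_bigr do rewrite mul0r lam0.
  by rewrite sumr_const -cardF; congr (_ *+ _); apply: eq_card.
case: lam_nontriv => x hx.
apply: (@sum_char_eq0 predT _ (a^-1 * x) (lam_scaleD a)) => //.
by rewrite mulVKf.
Qed.

(** By orthogonality the double sum over all s and all t of trace zero is q^2, while s = 0
    contributes only q. So some other s has a nonzero inner sum, and its character is trivial on the
    elements of trace zero. *)
Lemma exists_trace0_annihilator :
  exists2 s, s != 0 & forall t, t + bar t = 0 -> lam (s * t) = 1.
Proof.
case: (pickP [pred s : F | (s != 0) &&
    [forall t, (t + bar t == 0) ==> (lam (s * t) == 1)]]) => [s /andP[s0 /forallP hs]|h].
  by exists s => // t ht; have := hs t; rewrite ht eqxx => /eqP.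
have : \sum_s \sum_(t | t + bar t == 0) lam (s * t) = (q ^ 2)%:R.
  rewrite exchange_big /= (bigD1 0) ?rmorph0 ?addr0 //= [X in _ + X]big1 ?addr0.
    by under eq_bigr do rewrite mulrC; rewrite sum_lam eqxx.
  move=> t /andP[_ t0]; under eq_bigr do rewrite mulrC.
  by rewrite sum_lam (negPf t0).
rewrite (bigD1 0) //= [X in _ + X]big1 ?addr0 => [|s s0].
  under eq_bigr do rewrite mul0r lam0.
  rewrite sumr_const -[X in _ *+ X]/#|[pred t : F | t + bar t == 0]| card_trace0.
  move/eqP; rewrite eqr_nat -{1}(expn1 q) eqn_exp2l //.
have := h s; rewrite /= s0 /= => /negbT /forallPn [t]; rewrite negb_imply => /andP[/eqP ht hl].
apply: (@sum_char_eq0 _ _ t (lam_scaleD s) hl) => y.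
by rewrite rmorphD addrACA ht add0r.
Qed.

(* [s0] makes [x |-> lam (s0 * x)] invariant under conjugation. *)
Variable s0 : F.
Hypotheses (s0_neq0 : s0 != 0) (s0_trace0 : forall t, t + bar t = 0 -> lam (s0 * t) = 1).

Definition psi x := lam (s0 * x).

Lemma psiD x y : psi (x + y) = psi x * psi y.
Proof. exact: lam_scaleD. Qed.

Lemma psi0 : psi 0 = 1. Proof. by rewrite /psi mulr0. Qed.

Lemma psi_scaleD a x y : psi (a * (x + y)) = psi (a * x) * psi (a * y).
Proof. by rewrite mulrDr psiD. Qed.

Lemma psi_trace x y : x + bar x = y + bar y -> psi x = psi y.
Proof.
move=> h; rewrite -(subrK y x) psiD [psi (x - y)]s0_trace0 ?mul1r //.
by rewrite rmorphB /= addrACA -opprD h subrr.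
Qed.

Lemma psi_bar x : psi (bar x) = psi x.
Proof. by apply: psi_trace; rewrite barK addrC. Qed.

Lemma psi_nontriv : exists x, psi x != 1.
Proof. by case: lam_nontriv => x hx; exists (s0^-1 * x); rewrite /psi mulVKf. Qed.

Lemma psi_trace0_nontriv v : bar v != v ->
  exists2 t, t + bar t = 0 & psi (v * t) != 1.
Proof.
move=> hv; case: psi_nontriv => x hx.
have hv' : v - bar v != 0 by rewrite subr_eq0 eq_sym.
have ht : bar ((x + bar x) / (v - bar v)) = - ((x + bar x) / (v - bar v)).
  by rewrite fmorph_div /= trace_fix rmorphB /= barK -[bar v - v]opprB invrN mulrN.
(* Chosen so that v times this element has the same trace as x. *)
exists ((x + bar x) / (v - bar v)); first by rewrite ht subrr.
apply: contra_neq hx => <-; apply: psi_trace.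
by rewrite rmorphM /= ht mulrN -mulrBl mulrCA divff // mulr1.
Qed.

Lemma psi_fix_nontriv a : a + bar a != 0 -> exists2 v, bar v = v & psi (a * v) != 1.
Proof.
move=> ha; case: psi_nontriv => x hx.
have hv : bar ((x + bar x) / (a + bar a)) = (x + bar x) / (a + bar a).
  by rewrite fmorph_div /= !trace_fix.
exists ((x + bar x) / (a + bar a)) => //.
apply: contra_neq hx => <-; apply: psi_trace.
by rewrite rmorphM /= hv -mulrDl mulrCA divff // mulr1.
Qed.

Lemma sum_psi_fix a : a + bar a != 0 -> \sum_(v | bar v == v) psi (a * v) = 0.
Proof.
move=> /psi_fix_nontriv [v hv hp].
apply: (sum_char_eq0 (psi_scaleD a) hp) => y.
by rewrite rmorphD /= hv (inj_eq (addrI v)).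
Qed.

Lemma sum_psi_trace_fiber v x0 :
  \sum_(x | x + bar x == x0 + bar x0) psi (v * x) =
  if bar v == v then q%:R * psi (v * x0) else 0.
Proof.
case: eqP => [hv|/eqP/psi_trace0_nontriv [t ht hp]].
  transitivity (\sum_(x | x + bar x == x0 + bar x0) psi (v * x0)).
    apply: eq_bigr => x /eqP hx; apply: psi_trace.
    by rewrite !rmorphM /= hv -!mulrDr hx.
  rewrite sumr_const -[X in _ *+ X]/#|[pred x : F | x + bar x == x0 + bar x0]|.
  by rewrite card_trace ?mulr_natl // trace_fix.
apply: (sum_char_eq0 (psi_scaleD v) hp) => y.
by rewrite rmorphD addrACA ht add0r.
Qed.

(** Here y = 0 gives 1, each nonzero fixed v is a norm q + 1 times, and the [psi (a * v)] over these
    v sum to -1. The total 1 - (q + 1) is the origin of the base - q below. *)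
Lemma sum_psi_norm a : a + bar a != 0 -> \sum_y psi (a * (y * bar y)) = - q%:R.
Proof.
move=> ha; rewrite (partition_big (fun y => y * bar y) [pred v : F | bar v == v]) /=; last first.
  by move=> y _; rewrite norm_fix.
rewrite (bigD1 0) ?rmorph0 //= (eq_bigl (pred1 0)) => [|y]; last by rewrite norm_eq0.
rewrite big_pred1_eq mul0r mulr0 psi0.
transitivity (1 + \sum_(v | (bar v == v) && (v != 0)) q.+1%:R * psi (a * v)).
  congr (_ + _); apply: eq_bigr => v /andP[/eqP hv v0].
  transitivity (\sum_(y | y * bar y == v) psi (a * v)); first by apply: eq_bigr => y /eqP <-.
  by rewrite sumr_const -[X in _ *+ X]/#|[pred y : F | y * bar y == v]| card_norm // mulr_natl.
rewrite -big_distrr /=; have := sum_psi_fix ha.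
rewrite (bigD1 0) ?rmorph0 //= mulr0 psi0 => /eqP; rewrite addrC addr_eq0 => /eqP ->.
by rewrite mulrN1 -natr1 opprD addrCA subrr addr0.
Qed.

Notation g1 := (G1 q chi lam).
Notation g2 := (G2 q chi lam).

Lemma norm1E a : (a ^+ q.+1 == 1) = (a * bar a == 1).
Proof. by rewrite barE exprS. Qed.

Lemma g1E : g1 = \sum_(a | a * bar a == 1) chi a * lam a.
Proof.
rewrite /G1 (reindex_inj oppr_inj) /=; apply: eq_big => a; last by rewrite opprK.
by rewrite norm1E rmorphN mulrNN.
Qed.

Lemma bar_neq0 x : x != 0 -> bar x != 0.
Proof. by rewrite fmorph_eq0. Qed.

(** The condition on b in [G2] reads [bar b = bar a * b] and defines an additive group, so the inner
    sum vanishes unless [lam] is trivial there. This happens only for [a = - s0 / bar s0], where the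
    group is s0 times the q elements of trace zero. *)
Lemma g2E : g2 = q%:R * chi (- s0 / bar s0).
Proof.
have bs0 := bar_neq0 s0_neq0.
have q0 : (0 < q)%N by apply: ltn_trans q_gt1.
have hb a b : ((b ^+ (q - 1) == a ^+ q) || (b == 0)) = (bar b == bar a * b).
  rewrite -barE; have [->|b0] := eqVneq b 0; first by rewrite orbT rmorph0 mulr0 eqxx.
  by rewrite orbF -(inj_eq (mulIf b0)) -exprSr -subSn // subn1 /= -barE.
rewrite /G2 (bigD1 (- s0 / bar s0)) /=; last first.
  by rewrite norm1E fmorph_div rmorphN /= barK mulf_div mulrNN [bar s0 * s0]mulrC divff ?mulf_neq0.
rewrite [X in _ + X]big1 ?addr0 => [|a /andP[]].
  rewrite mulrC; congr (_ * _).
  transitivity (\sum_(b | b + bar b == 0) lam (- (s0 * b))).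
    rewrite (reindex_inj (mulfI s0_neq0)); apply: eq_big => // b; rewrite hb.
    rewrite fmorph_div /= rmorphN /= barK rmorphM /= mulrA mulNr mulNr mulfVK //.
    by rewrite mulNr -mulrN (inj_eq (mulfI bs0)) -addr_eq0 addrC.
  transitivity (\sum_(b | b + bar b == 0) (1 : C)); last first.
    by rewrite sumr_const -[X in _ *+ X]/#|[pred b : F | b + bar b == 0]| card_trace0.
  apply: eq_bigr => b /eqP hb0; rewrite -mulrN s0_trace0 //.
  by rewrite rmorphN -opprD hb0 oppr0.
rewrite norm1E => /eqP ha hne; rewrite (_ : \sum_(b | _) _ = 0) ?mulr0 //.
have bs0' : bar s0 / s0 != 0 by rewrite mulf_neq0 ?invr_eq0.
(* This [mu] has norm one and is not -1. The elements [s0 * (y + bar (mu * y))] lie in the group,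
   and as [psi] is invariant under [bar], the values of [lam] at them are the [psi ((1 + mu) * y)],
   not all equal to 1. *)
pose mu := bar a * s0 / bar s0.
have mu1 : 1 + mu != 0.
  apply: contra_neq hne => h; have hmu : mu = -1 by apply/eqP; rewrite -addr_eq0 addrC h.
  have: a * mu * bar s0 = s0 by rewrite /mu !mulrA ha mul1r divfK.
  rewrite hmu mulrN1 mulNr => /(congr1 -%R); rewrite opprK => h2.
  exact: (canRL (mulfK bs0)).
have hmu : bar s0 * mu = bar a * s0 by rewrite /mu mulrC divfK.
case: psi_nontriv => z hz.
have [y hy] : exists y, z = - (y + mu * y).
  by exists (- (z / (1 + mu))); field.
have hx : psi (- (y + bar (mu * y))) = psi z.
  apply: psi_trace; rewrite rmorphN rmorphD /= barK hy rmorphN !rmorphD /=.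
  by ring.
apply: (@sum_char_eq0 _ (fun b => lam (- b)) (s0 * (y + bar (mu * y)))) => [b c|| b].
- by rewrite opprD lamD.
- by rewrite -mulrN; rewrite /psi in hx; rewrite hx.
rewrite !hb rmorphD /= (_ : bar (s0 * _) = bar a * (s0 * (y + bar (mu * y)))).
  by rewrite [X in _ == X]mulrDr (inj_eq (addrI _)).
have hmm : mu * bar mu = 1.
  rewrite /mu fmorph_div rmorphM /= !barK -[RHS]ha.
  by field; rewrite s0_neq0 bs0.
rewrite rmorphM /= rmorphD /= barK mulrA -hmu -mulrA; congr (_ * _).
by rewrite mulrDr rmorphM mulrA hmm mul1r addrC.
Qed.

(** * Hermitian products and unitary matrices *)

Definition adj m n (A : 'M[F]_(m, n)) : 'M[F]_(n, m) := (map_mx bar A)^T.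

Lemma adjM m n p (A : 'M[F]_(m, n)) (B : 'M[F]_(n, p)) : adj (A *m B) = adj B *m adj A.
Proof. by rewrite /adj map_mxM trmx_mul. Qed.

Lemma adjK m n (A : 'M[F]_(m, n)) : adj (adj A) = A.
Proof. by apply/matrixP => i j; rewrite !mxE barK. Qed.

Lemma adj1 n : adj (1%:M : 'M[F]_n) = 1%:M.
Proof. by rewrite /adj map_mx1 trmx1. Qed.

Lemma adj0 m n : adj (0 : 'M[F]_(m, n)) = 0.
Proof. by rewrite /adj map_mx0 trmx0. Qed.

Lemma adjD m n (A B : 'M[F]_(m, n)) : adj (A + B) = adj A + adj B.
Proof. by apply/matrixP => i j; rewrite !mxE rmorphD. Qed.

Lemma adjZ m n a (A : 'M[F]_(m, n)) : adj (a *: A) = bar a *: adj A.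
Proof. by apply/matrixP => i j; rewrite !mxE rmorphM. Qed.

Lemma adj_scalar n a : adj (a%:M : 'M[F]_n) = (bar a)%:M.
Proof. by rewrite /adj map_scalar_mx tr_scalar_mx. Qed.

Lemma adj_col m1 m2 n (A : 'M[F]_(m1, n)) (B : 'M[F]_(m2, n)) :
  adj (col_mx A B) = row_mx (adj A) (adj B).
Proof. by rewrite /adj map_col_mx tr_col_mx. Qed.

Lemma adj_row m n1 n2 (A : 'M[F]_(m, n1)) (B : 'M[F]_(m, n2)) :
  adj (row_mx A B) = col_mx (adj A) (adj B).
Proof. by rewrite /adj map_row_mx tr_row_mx. Qed.

Lemma adj_block m1 m2 n1 n2 (A : 'M[F]_(m1, n1)) (B : 'M[F]_(m1, n2))
    (D : 'M[F]_(m2, n1)) (E : 'M[F]_(m2, n2)) :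
  adj (block_mx A B D E) = block_mx (adj A) (adj D) (adj B) (adj E).
Proof. by rewrite /adj map_block_mx tr_block_mx. Qed.

Definition hdot m (x y : 'cV[F]_m) : F := (adj x *m y) 0 0.

Lemma hdotE m (x y : 'cV_m) : adj x *m y = (hdot x y)%:M.
Proof. by rewrite [LHS]mx11_scalar. Qed.

Lemma hdotC m (x y : 'cV_m) : bar (hdot x y) = hdot y x.
Proof.
have := congr1 (fun A : 'M[F]_1 => adj A 0 0) (hdotE x y).
by rewrite adjM adjK adj_scalar [RHS]mxE eqxx mulr1n => <-.
Qed.

Lemma hdotDl m (x y z : 'cV_m) : hdot (x + y) z = hdot x z + hdot y z.
Proof. by rewrite /hdot adjD mulmxDl mxE. Qed.

Lemma hdotDr m (x y z : 'cV_m) : hdot z (x + y) = hdot z x + hdot z y.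
Proof. by rewrite /hdot mulmxDr mxE. Qed.

Lemma hdotNl m (x z : 'cV_m) : hdot (- x) z = - hdot x z.
Proof. by rewrite -scaleN1r /hdot adjZ -scalemxAl mxE rmorphN1 mulN1r. Qed.

Lemma hdotNr m (x z : 'cV_m) : hdot z (- x) = - hdot z x.
Proof. by rewrite /hdot mulmxN mxE. Qed.

Lemma hdotZl m a (x z : 'cV_m) : hdot (a *: x) z = bar a * hdot x z.
Proof. by rewrite /hdot adjZ -scalemxAl mxE. Qed.

Lemma hdotZr m a (x z : 'cV_m) : hdot z (a *: x) = a * hdot z x.
Proof. by rewrite /hdot -scalemxAr mxE. Qed.

Lemma hdot0r m (z : 'cV_m) : hdot z 0 = 0.
Proof. by rewrite /hdot mulmx0 mxE. Qed.

Lemma hdot0l m (z : 'cV_m) : hdot 0 z = 0.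
Proof. by rewrite /hdot adj0 mul0mx mxE. Qed.

Lemma hdot_col m1 m2 (x x' : 'cV_m1) (y y' : 'cV_m2) :
  hdot (col_mx x y) (col_mx x' y') = hdot x x' + hdot y y'.
Proof. by rewrite /hdot adj_col mul_row_col mxE. Qed.

Lemma hdot_scalar a b : hdot (a%:M : 'cV_1) b%:M = bar a * b.
Proof. by rewrite /hdot adj_scalar -scalar_mxM mxE. Qed.

Definition unitary n : {set 'M[F]_n} := [set g : 'M[F]_n | adj g *m g == 1%:M].

Lemma unitaryP n (g : 'M[F]_n) : reflect (adj g *m g = 1%:M) (g \in unitary n).
Proof. by rewrite inE; exact: eqP. Qed.

Lemma unitary_adjr n (g : 'M[F]_n) : g \in unitary n -> g *m adj g = 1%:M.
Proof. by move/unitaryP/mulmx1C. Qed.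

Lemma unitary_adj n (g : 'M[F]_n) : g \in unitary n -> adj g \in unitary n.
Proof. by move=> /unitary_adjr hg; apply/unitaryP; rewrite adjK. Qed.

Lemma unitary_mul n (g h : 'M[F]_n) :
  g \in unitary n -> h \in unitary n -> g *m h \in unitary n.
Proof.
move=> /unitaryP hg /unitaryP hh; apply/unitaryP.
by rewrite adjM -mulmxA (mulmxA _ g) hg mul1mx.
Qed.

Lemma unitary1 n : 1%:M \in unitary n.
Proof. by apply/unitaryP; rewrite adj1 mul1mx. Qed.

Lemma unitary_mull n (g h : 'M[F]_n) :
  h \in unitary n -> (h *m g \in unitary n) = (g \in unitary n).
Proof.
move=> hU; apply/idP/idP => [hg|]; last exact: unitary_mul.
have := unitary_mul (unitary_adj hU) hg.
by rewrite mulmxA (unitaryP _ hU) mul1mx.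
Qed.

Lemma unitary_mulr n (g h : 'M[F]_n) :
  h \in unitary n -> (g *m h \in unitary n) = (g \in unitary n).
Proof.
move=> hU; apply/idP/idP => [hg|]; last by move=> gU; exact: unitary_mul.
have := unitary_mul hg (unitary_adj hU).
by rewrite -mulmxA unitary_adjr // mulmx1.
Qed.

Lemma det_adj n (g : 'M[F]_n) : \det (adj g) = bar (\det g).
Proof. by rewrite /adj det_tr det_map_mx. Qed.

Lemma unitary_det n (g : 'M[F]_n) : g \in unitary n -> \det g * bar (\det g) = 1.
Proof. by move=> /unitary_adjr /(congr1 determinant); rewrite det_mulmx det_adj det1. Qed.

Lemma unitary_det_neq0 n (g : 'M[F]_n) : g \in unitary n -> \det g != 0.
Proof.
by move=> /unitary_det; apply: contra_eq_neq => ->; rewrite mul0r eq_sym oner_eq0.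
Qed.

Lemma hdot_unitary n (g : 'M[F]_n) x y : g \in unitary n -> hdot (g *m x) (g *m y) = hdot x y.
Proof. by move=> /unitaryP gU; rewrite /hdot adjM -mulmxA (mulmxA _ g) gU mul1mx. Qed.

Lemma sum_unitary_mull (T : nmodType) n (h : 'M[F]_n) (f : 'M[F]_n -> T) : h \in unitary n ->
  \sum_(g in unitary n) f (h *m g) = \sum_(g in unitary n) f g.
Proof.
move=> hU; rewrite [RHS](reindex (mulmx h)) /=.
  by apply: eq_bigl => g; rewrite unitary_mull.
exists (mulmx (adj h)) => g _; first by rewrite mulmxA (unitaryP _ hU) mul1mx.
by rewrite mulmxA unitary_adjr // mul1mx.
Qed.

Lemma sum_unitary_mulr (T : nmodType) n (h : 'M[F]_n) (f : 'M[F]_n -> T) : h \in unitary n ->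
  \sum_(g in unitary n) f (g *m h) = \sum_(g in unitary n) f g.
Proof.
move=> hU; rewrite [RHS](reindex (mulmx^~ h)) /=.
  by apply: eq_bigl => g; rewrite unitary_mulr.
exists (mulmx^~ (adj h)) => g _ /=; last by rewrite -mulmxA (unitaryP _ hU) mulmx1.
by rewrite -mulmxA unitary_adjr // mulmx1.
Qed.

(** * Twisted character sums and quasi-reflections *)

Definition Phi n (M : 'M[F]_n) : C := \sum_(g in unitary n) chi (\det g) * lam (\tr (M *m g)).

Lemma Phi_mulr n (M h : 'M[F]_n) : h \in unitary n -> Phi (M *m h) = (chi (\det h))^-1 * Phi M.
Proof.
move=> hU; rewrite /Phi -(sum_unitary_mull (fun g => chi (\det g) * lam (\tr (M *m g))) hU).
rewrite big_distrr /=; apply: eq_bigr => g _.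
by rewrite det_mulmx chiM !mulrA mulVf ?mul1r ?mulmxA // chi_neq0 // unitary_det_neq0.
Qed.

Lemma Phi_mull n (M h : 'M[F]_n) : h \in unitary n -> Phi (h *m M) = (chi (\det h))^-1 * Phi M.
Proof.
move=> hU; rewrite /Phi -(sum_unitary_mulr (fun g => chi (\det g) * lam (\tr (M *m g))) hU).
rewrite big_distrr /=; apply: eq_bigr => g _.
rewrite det_mulmx chiM -mulmxA mxtrace_mulC -mulmxA [chi (\det g) * chi _]mulrC !mulrA.
by rewrite mulVf ?mul1r // chi_neq0 // unitary_det_neq0.
Qed.

(** The rank-one term adds a <z, g z> to the trace of g, so the sum is twisted by a single matrix
    coefficient. *)
Definition Psi n a (z : 'cV_n) := Phi (1%:M + a *: (z *m adj z)).

Lemma Psi_conj n a (z : 'cV_n) h : h \in unitary n -> Psi a (h *m z) = Psi a z.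
Proof.
move=> hU; have -> : Psi a (h *m z) = Phi (h *m (1%:M + a *: (z *m adj z)) *m adj h).
  rewrite /Psi mulmxDr mulmxDl mulmx1 unitary_adjr // -scalemxAr -scalemxAl.
  by rewrite adjM !mulmxA.
rewrite Phi_mulr ?unitary_adj // Phi_mull // mulrA -invfM -chiM -det_mulmx.
by rewrite (unitaryP _ hU) det1 chi1 invr1 mul1r.
Qed.

Lemma Psi_scale n a d (z : 'cV_n) : Psi a (d *: z) = Psi (a * (d * bar d)) z.
Proof. by rewrite /Psi adjZ -scalemxAl -scalemxAr !scalerA mulrA. Qed.

Lemma Psi_z0 n a : Psi a (0 : 'cV_n) = Phi (1%:M : 'M[F]_n).
Proof. by rewrite /Psi mul0mx scaler0 addr0. Qed.

Lemma Psi_a0 n (z : 'cV_n) : Psi 0 z = Phi (1%:M : 'M[F]_n).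
Proof. by rewrite /Psi scale0r addr0. Qed.

(* Both sides are the determinant of [block_mx 1 (- v) u 1]. *)
Lemma det_rank1 n (u : 'cV[F]_n) (v : 'rV_n) : \det (1%:M + u *m v) = 1 + (v *m u) 0 0.
Proof.
have h1 : block_mx 1%:M (- v) u 1%:M =
    block_mx 1%:M 0 u 1%:M *m block_mx 1%:M (- v) 0 (1%:M + u *m v).
  by rewrite mulmx_block ?(mul1mx, mul0mx, mulmx1) !addr0 mulmxN addrCA addNr addr0.
have h2 : block_mx 1%:M (- v) u 1%:M =
    block_mx (1%:M + v *m u) (- v) 0 1%:M *m block_mx 1%:M 0 u 1%:M.
  by rewrite mulmx_block ?(mul1mx, mul0mx, mulmx1, mulmx0) !add0r mulNmx addrK.
have := congr1 determinant (etrans (esym h1) h2).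
rewrite !det_mulmx !det_lblock !det_ublock !det1 !mul1r !mulr1 => ->.
by rewrite det_mx11 !mxE.
Qed.

(* For [t] as in [refl_unitary] this is a quasi-reflection, or a transvection when [y] is
   isotropic; in both cases [refl_map] applies. *)
Definition refl n (y : 'cV[F]_n) t : 'M[F]_n := 1%:M + t *: (y *m adj y).

Lemma refl_unitary n (y : 'cV_n) t : t + bar t + t * bar t * hdot y y = 0 ->
  refl y t \in unitary n.
Proof.
move=> ht; apply/unitaryP; rewrite /refl adjD adj1 adjZ adjM adjK.
rewrite mulmxDl mul1mx mulmxDr mulmx1 -addrA -[RHS]addr0; congr (_ + _).
rewrite -scalemxAl -scalemxAr mulmxA -(mulmxA y) hdotE mul_mx_scalar -scalemxAl.
by rewrite !scalerA -!scalerDl -[RHS](scale0r (y *m adj y)) -ht; congr (_ *: _); ring.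
Qed.

Lemma refl_det n (y : 'cV_n) t : \det (refl y t) = 1 + t * hdot y y.
Proof. by rewrite /refl scalemxAl det_rank1 -scalemxAr mxE. Qed.

(** With d = <w - u, u>, equality of the norms gives <w - u, w - u> = - (d + bar d), which is the
    condition of [refl_unitary] for t = 1 / d. *)
Lemma refl_map n (u w : 'cV_n) : hdot u u = hdot w w -> hdot (w - u) u != 0 ->
  refl (w - u) (hdot (w - u) u)^-1 *m u = w /\ refl (w - u) (hdot (w - u) u)^-1 \in unitary n.
Proof.
move=> huw h0; split.
  rewrite /refl mulmxDl mul1mx -scalemxAl -mulmxA hdotE mul_mx_scalar scalerA mulVf //.
  by rewrite scale1r addrC subrK.
apply: refl_unitary; rewrite fmorphV /= hdotC.
have h1 : hdot u (w - u) != 0 by rewrite -hdotC bar_neq0.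
have -> : hdot (w - u) (w - u) = - (hdot (w - u) u + hdot u (w - u)).
  by rewrite !(hdotDl, hdotDr, hdotNl, hdotNr) huw; ring.
by field; rewrite h0 h1.
Qed.

(** * Sorting unitary matrices by their first column *)

Lemma sum_cV_S (T : nmodType) m (f : 'cV[F]_(1 + m) -> T) :
  \sum_x f x = \sum_a \sum_(y : 'cV_m) f (col_mx a%:M y).
Proof.
rewrite pair_big /= (reindex (fun p : F * 'cV_m => col_mx (p.1%:M : 'cV_1) p.2)) //=.
have hx (x : 'cV_(1 + m)) : x 0 0 = usubmx x 0 0.
  by rewrite mxE; congr (x _ _); apply: val_inj.
exists (fun x : 'cV_(1 + m) => (x 0 0, dsubmx x)) => [[a y] _ | x _] /=.
  by rewrite hx col_mxKd col_mxKu mxE eqxx.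
by rewrite hx -mx11_scalar vsubmxK.
Qed.

Lemma sum_psi_hdot m a : a + bar a != 0 ->
  \sum_(y : 'cV_m) psi (a * hdot y y) = (- q%:R) ^+ m.
Proof.
move=> ha; elim: m => [|m IH].
  rewrite (bigD1 0) //= big1 ?addr0 ?hdot0r ?mulr0 ?psi0 ?expr0 // => y.
  by rewrite (flatmx0 y) eqxx.
rewrite exprS -[m.+1]/(1 + m)%N sum_cV_S -IH -(sum_psi_norm ha) big_distrl /=.
apply: eq_bigr => b _; rewrite big_distrr /=; apply: eq_bigr => y _.
by rewrite hdot_col hdot_scalar [bar b * b]mulrC psi_scaleD.
Qed.

Notation Q := (- q%:R : C).

Definition cnt m c : C := \sum_(x : 'cV[F]_m | hdot x x == c) 1.

Lemma q_neq0 : (q%:R : C) != 0.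
Proof. by rewrite pnatr_eq0 -lt0n (ltn_trans _ q_gt1). Qed.

Lemma Q_neq0 : Q != 0. Proof. by rewrite oppr_eq0 q_neq0. Qed.

Lemma hdot_fix m (x : 'cV_m) : bar (hdot x x) = hdot x x.
Proof. exact: hdotC. Qed.

Lemma sum_cnt m : \sum_(c | bar c == c) cnt m c = q%:R ^+ (2 * m).
Proof.
transitivity (\sum_(x : 'cV[F]_m) (1 : C)).
  rewrite [RHS](partition_big (fun x : 'cV_m => hdot x x) (fun c => bar c == c)) //.
  by move=> x _; rewrite hdot_fix.
by rewrite sumr_const card_mx cardF muln1 -expnM natrX.
Qed.

(** Sort by the norm v of the first coordinate: v = 0 occurs once and every other v occurs q + 1
    times, while the [cnt m (c - v)] over all v add up to the number of vectors. *)
Lemma cntS m c : bar c = c -> cnt m.+1 c = (q%:R + 1) * q%:R ^+ (2 * m) - q%:R * cnt m c.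
Proof.
move=> hc.
transitivity (\sum_a cnt m (c - a * bar a)).
  rewrite /cnt -[m.+1]/(1 + m)%N big_mkcond sum_cV_S; apply: eq_bigr => a _.
  rewrite [RHS]big_mkcond; apply: eq_bigr => y _.
  congr (if _ then _ else _); rewrite hdot_col hdot_scalar.
  by apply/eqP/eqP => [<-|->]; ring.
rewrite (partition_big (fun a => a * bar a) (fun v => bar v == v)) /=; last first.
  by move=> a _; rewrite norm_fix.
rewrite (bigD1 0) ?rmorph0 //= (eq_bigl (pred1 0)) => [|a]; last by rewrite norm_eq0.
rewrite big_pred1_eq mul0r subr0.
transitivity (cnt m c + \sum_(v | (bar v == v) && (v != 0)) (q%:R + 1) * cnt m (c - v)).
  congr (_ + _); apply: eq_bigr => v /andP[/eqP hv v0].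
  transitivity (\sum_(a | a * bar a == v) cnt m (c - v)); first by apply: eq_bigr => a /eqP <-.
  by rewrite sumr_const -[X in _ *+ X]/#|[pred y : F | y * bar y == v]| card_norm // natr1 mulr_natl.
rewrite -big_distrr /=.
have := sum_cnt m; rewrite (reindex_inj (inv_inj (subKr c))) /=.
rewrite (eq_bigl (fun v => bar v == v)) => [|v]; last first.
  by rewrite rmorphB /= hc (inj_eq (addrI c)) eqr_opp.
by rewrite (bigD1 0) ?rmorph0 //= subr0 => <-; ring.
Qed.

Lemma cntE m c : bar c = c -> q%:R * cnt m c = Q ^+ (2 * m) - Q ^+ m + (c == 0)%:R * q%:R * Q ^+ m.
Proof.
elim: m => [|m IH] hc.
  rewrite muln0 !expr0 subrr add0r mulr1 mulrC; congr (_ * _).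
  rewrite /cnt big_mkcond (bigD1 0) //= big1 ?addr0 => [|y].
    by rewrite hdot0r eq_sym; case: eqP.
  by rewrite (flatmx0 y) eqxx.
have hQ k : q%:R ^+ (2 * k) = (Q ^+ k) ^+ 2 by rewrite exprAC sqrrN exprM.
have hQ' k : Q ^+ (2 * k) = (Q ^+ k) ^+ 2 by rewrite -exprM mulnC.
rewrite cntS // mulrBr IH // hQ !hQ' (exprS _ m).
by move: (Q ^+ m) (_%:R : C) => X b; ring.
Qed.

Definition evec m : 'cV[F]_(1 + m) := col_mx 1%:M 0.

Definition lift1 m (d : 'M[F]_m) : 'M[F]_(1 + m) := block_mx 1%:M 0 0 d.

Lemma hdot_evec m : hdot (evec m) (evec m) = 1.
Proof. by rewrite hdot_col hdot_scalar hdot0r rmorph1 mulr1 addr0. Qed.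

Lemma lift1_unitary m (d : 'M[F]_m) : (lift1 d \in unitary (1 + m)) = (d \in unitary m).
Proof.
rewrite !inE /lift1 adj_block adj1 !adj0 mulmx_block ?(mulmx0, mul0mx, mulmx1) !addr0 !add0r.
by rewrite scalar_mx_block; apply/eqP/eqP => [/eq_block_mx[]|->].
Qed.

Lemma lift1_evec m (d : 'M[F]_m) : lift1 d *m evec m = evec m.
Proof. by rewrite /lift1 /evec mul_block_col mul1mx !mulmx0 mul0mx !addr0. Qed.

Lemma det_lift1 m (d : 'M[F]_m) : \det (lift1 d) = \det d.
Proof. by rewrite /lift1 det_ublock det1 mul1r. Qed.

(** The adjoint of g fixes the vector as well, so the first row is trivial along with the first
    column. *)
Lemma stab_evec m (g : 'M[F]_(1 + m)) : g \in unitary (1 + m) -> g *m evec m = evec m ->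
  g = lift1 (drsubmx g).
Proof.
move=> gU hg; have hg' : adj g *m evec m = evec m.
  by rewrite -{1}hg mulmxA (unitaryP _ gU) mul1mx.
move: hg hg'; rewrite -[g]submxK; move: (ulsubmx g) (ursubmx g) (dlsubmx g) (drsubmx g).
move=> A B D E; rewrite adj_block /evec !mul_block_col !mulmx1 !mulmx0 !addr0.
move=> /eq_col_mx[-> ->] /eq_col_mx[_ hB]; rewrite block_mxKdr /lift1.
by rewrite -[B]adjK hB adj0.
Qed.

(** The g with a prescribed first column form one coset of the stabilizer, a copy of U(m,q). *)
Lemma sum_unitary_evec (T : nmodType) m (R : 'M[F]_(1 + m)) (f : 'M[F]_(1 + m) -> T) :
  R \in unitary (1 + m) ->
  \sum_(g in unitary (1 + m) | g *m evec m == R *m evec m) f g =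
  \sum_(d in unitary m) f (R *m lift1 d).
Proof.
move=> RU; rewrite (reindex_onto (fun d => R *m lift1 d) (fun g => drsubmx (adj R *m g))) /=.
  apply: eq_bigl => d; rewrite mulmxA (unitaryP _ RU) mul1mx block_mxKdr eqxx andbT.
  by rewrite unitary_mull // lift1_unitary -mulmxA lift1_evec eqxx andbT.
move=> g /andP[gU /eqP hg].
rewrite -stab_evec ?unitary_mull ?unitary_adj //; first by rewrite mulmxA unitary_adjr // mul1mx.
by rewrite -mulmxA hg mulmxA (unitaryP _ RU) mul1mx.
Qed.

Lemma hdot_evecl m (x : 'cV_(1 + m)) : hdot (evec m) x = usubmx x 0 0.
Proof.
rewrite -{1}[x]vsubmxK /evec hdot_col hdot0l addr0.
by rewrite {1}[usubmx x]mx11_scalar hdot_scalar rmorph1 mul1r.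
Qed.

Definition rot1 m a : 'M[F]_(1 + m) := block_mx a%:M 0 0 1%:M.

Lemma rot1_unitary m a : a * bar a = 1 -> rot1 m a \in unitary (1 + m).
Proof.
move=> ha; apply/unitaryP; rewrite /rot1 adj_block adj1 !adj0 adj_scalar mulmx_block.
rewrite ?(mulmx0, mul0mx, mulmx1) !addr0 !add0r -scalar_mxM [bar a * a]mulrC ha.
by rewrite -scalar_mx_block.
Qed.

Lemma rot1_evec m a : rot1 m a *m evec m = a *: evec m.
Proof.
rewrite /rot1 /evec mul_block_col ?(mulmx0, mul0mx, mulmx1) !addr0.
by rewrite scale_col_mx scaler0 scale_scalar_mx mulr1.
Qed.

Lemma exists_unitary_evec m (x : 'cV_(1 + m)) : hdot x x = 1 ->
  exists2 R, R \in unitary (1 + m) & R *m evec m = x.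
Proof.
move=> hx; case: (exists_norm1_neq (hdot (evec m) x)) => a ha hne.
have a0 : a != 0 by rewrite -norm_eq0 ha oner_eq0.
(* The choice of a makes <w, e> differ from 1 = <e, e>, as [refl_map] requires; [rot1] undoes the
   scaling afterwards. *)
pose w := bar a *: x.
have hw : hdot (evec m) (evec m) = hdot w w.
  by rewrite /w hdotZl hdotZr hx hdot_evec mulr1 barK ha.
have hwe : hdot (w - evec m) (evec m) != 0.
  rewrite hdotDl hdotNl hdot_evec subr_eq0 /w hdotZl barK -hdotC.
  apply: contra_neq hne => h; apply: (fmorph_inj bar); apply: (mulfI a0).
  by rewrite ha h.
have [h1 h2] := refl_map hw hwe.
exists (refl (w - evec m) (hdot (w - evec m) (evec m))^-1 *m rot1 m a).
  by rewrite unitary_mul ?rot1_unitary.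
by rewrite -mulmxA rot1_evec -scalemxAr h1 /w scalerA ha scale1r.
Qed.

Definition charsum n := Phi (1%:M : 'M[F]_n).

(* Psi (k - 1) (evec m) weights the entry of [g] at the first basis vector by [k]. *)
Definition fsum m k := Psi (k - 1) (evec m).

Lemma fsum1 m : fsum m 1 = charsum (1 + m).
Proof. by rewrite /fsum subrr Psi_a0. Qed.

(** As the norm is surjective, z is a multiple d of a unit vector, and unit vectors form one orbit;
    the factor d bar d = <z, z> is absorbed into a. *)
Lemma Psi_anisotropic m a (z : 'cV_(1 + m)) : hdot z z != 0 ->
  Psi a z = fsum m (1 + a * hdot z z).
Proof.
move=> hz; case: (exists_norm (hdot_fix z) hz) => d d0 hd.
have bd0 := bar_neq0 d0.
have hx : hdot (d^-1 *: z) (d^-1 *: z) = 1.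
  by rewrite hdotZl hdotZr -hd fmorphV; field; rewrite d0 bd0.
case: (exists_unitary_evec hx) => R RU hR.
have -> : z = d *: (R *m evec m) by rewrite hR scalerA divff // scale1r.
rewrite Psi_scale Psi_conj // /fsum hdotZl hdotZr hdot_unitary // hdot_evec mulr1.
by congr Psi; ring.
Qed.

(** The quasi-reflection multiplying the basis vector by c is unitary of determinant c, and
    translating the sum by it replaces k by k * c. *)
Lemma fsum_norm1 m k c : c * bar c = 1 -> fsum m (k * c) = (chi c)^-1 * fsum m k.
Proof.
move=> hc; have hU : refl (evec m) (c - 1) \in unitary (1 + m).
  apply: refl_unitary; rewrite hdot_evec rmorphB rmorph1 /= mulr1.
  by transitivity (c * bar c - 1); [ring | rewrite hc subrr].
have hd : \det (refl (evec m) (c - 1)) = c by rewrite refl_det hdot_evec mulr1 addrC subrK.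
rewrite /fsum -[in RHS]hd -Phi_mulr // /Psi /refl; congr Phi.
rewrite mulmxDl mul1mx mulmxDr mulmx1 -scalemxAl -scalemxAr -!mulmxA (mulmxA (adj _)) hdotE.
rewrite hdot_evec mul1mx -addrA scalerA -!scalerDl; congr (_ + _ *: _); ring.
Qed.

(** Only the lower block enters the trace: the corner entry <e, g e> is determined by x and is
    factored out in [fsum_bsum]. *)
Definition bsum m (x : 'cV[F]_(1 + m)) : C :=
  \sum_(g in unitary (1 + m) | g *m evec m == x) chi (\det g) * lam (\tr (drsubmx g)).

Lemma fsum_bsum m k :
  fsum m k = \sum_(x | hdot x x == 1) lam (k * hdot (evec m) x) * bsum x.
Proof.
rewrite /fsum /Psi /Phi (partition_big (fun g => g *m evec m) (fun x => hdot x x == 1)) /=.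
  apply: eq_bigr => x _; rewrite big_distrr /=; apply: eq_bigr => g /andP[_ /eqP <-].
  rewrite mulrCA -lamD; congr (_ * lam _).
  rewrite mulmxDl mul1mx mxtraceD -scalemxAl mxtraceZ -mulmxA mxtrace_mulC -mulmxA hdotE.
  have -> : \tr g = hdot (evec m) (g *m evec m) + \tr (drsubmx g).
    rewrite hdot_evecl -{1 2}[g]submxK mxtrace_block /evec mul_block_col col_mxKu.
    by rewrite mulmx1 mulmx0 addr0 trace_mx11.
  by rewrite mxtrace_scalar mulr1n; ring.
by move=> g gU; rewrite hdot_unitary ?hdot_evec.
Qed.

Lemma bsum_unitary m (R : 'M[F]_(1 + m)) : R \in unitary (1 + m) ->
  bsum (R *m evec m) = chi (\det R) * Phi (drsubmx R).
Proof.
move=> RU; rewrite /bsum sum_unitary_evec // big_distrr /=; apply: eq_bigr => d _.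
rewrite det_mulmx det_lift1 chiM mulrA; congr (_ * lam (\tr _)).
by rewrite -[R in LHS]submxK /lift1 mulmx_block block_mxKdr mulmx0 add0r.
Qed.

Lemma bsum_rot m a (x : 'cV_(1 + m)) : a * bar a = 1 -> bsum (a *: x) = chi a * bsum x.
Proof.
move=> ha; have DU := rot1_unitary m ha.
have a0 : a != 0 by rewrite -norm_eq0 ha oner_eq0.
rewrite /bsum !big_mkcondr big_distrr /= -(sum_unitary_mulr _ DU); apply: eq_bigr => g _.
rewrite -mulmxA rot1_evec -scalemxAr (inj_eq (scalerI a0)); case: eqP => // _; last by rewrite mulr0.
rewrite det_mulmx [\det (rot1 m a)]det_ublock det_scalar1 det1 mulr1 chiM mulrCA !mulrA.
congr (_ * lam (\tr _)).
by rewrite -[g in LHS]submxK /rot1 mulmx_block block_mxKdr mulmx0 add0r mulmx1.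
Qed.

(** The quasi-reflection taking the basis vector to x serves as coset representative; its lower
    block is again the identity plus a rank-one term, along z. *)
Lemma bsum_refl m c (z : 'cV_m) : c * bar c + hdot z z = 1 -> c != 1 ->
  bsum (col_mx c%:M z) = chi ((1 - c) / (bar c - 1)) * Psi (bar c - 1)^-1 z.
Proof.
move=> hx hc; set x : 'cV_(1 + m) := col_mx _ _.
have hxe : x - evec m = col_mx (c - 1)%:M z.
  by rewrite /x /evec opp_col_mx add_col_mx subr0 raddfB.
have hxx : hdot (evec m) (evec m) = hdot x x.
  by rewrite hdot_evec /x hdot_col hdot_scalar -hx [c * _]mulrC.
have ht : hdot (x - evec m) (evec m) = bar c - 1.
  by rewrite hxe /evec hdot_col hdot0r hdot_scalar mulr1 addr0 rmorphB rmorph1.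
have hc' : bar c - 1 != 0 by rewrite -(rmorph1 bar) -rmorphB fmorph_eq0 subr_eq0.
have [|h1 h2] := @refl_map _ (evec m) x hxx; first by rewrite ht.
rewrite -h1 bsum_unitary // refl_det ht; congr (chi _ * _).
  rewrite hxe hdot_col hdot_scalar.
  have -> : hdot z z = 1 - c * bar c by rewrite -hx addrC addKr.
  by rewrite rmorphB rmorph1; field.
rewrite /Psi /refl hxe adj_col mul_col_row.
by rewrite scalar_mx_block scale_block_mx add_block_mx block_mxKdr.
Qed.

Lemma bsum_generic m c (z : 'cV_(1 + m)) : c * bar c + hdot z z = 1 -> hdot z z != 0 ->
  bsum (col_mx c%:M z) = fsum m (bar c).
Proof.
move=> hx hz; have hcc : c * bar c != 1.
  by apply: contra_neq hz => h; move: hx; rewrite h -[RHS]addr0 => /addrI.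
have hc : c != 1 by apply: contra_neq hcc => ->; rewrite rmorph1 mulr1.
have hc' : bar c - 1 != 0 by rewrite -(rmorph1 bar) -rmorphB fmorph_eq0 subr_eq0.
rewrite bsum_refl // Psi_anisotropic //.
have hc1 : 1 - c != 0 by rewrite subr_eq0 eq_sym.
have hd0 : (1 - c) / (bar c - 1) != 0 by rewrite mulf_neq0 ?invr_eq0.
(* The quotient has norm one, so extracting it by [fsum_norm1] cancels the value of chi coming from
   [bsum_refl]. *)
have -> : 1 + (bar c - 1)^-1 * hdot z z = bar c * ((1 - c) / (bar c - 1)).
  have -> : hdot z z = 1 - c * bar c by rewrite -hx addrC addKr.
  by field.
rewrite fsum_norm1 ?mulVKf ?chi_neq0 //.
rewrite fmorph_div !rmorphB !rmorph1 /= barK; field; rewrite hc' andbT.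
by rewrite subr_eq0.
Qed.

(* [bsum_refl] needs [c != 1]; rotating by a norm-one [a] with [a * c != 1] arranges that. *)
Lemma bsum_isotropic m c (z : 'cV_m) : c * bar c = 1 -> hdot z z = 0 ->
  exists2 t, t + bar t = -1 & bsum (col_mx c%:M z) = chi c * Psi t z.
Proof.
move=> hc hz; case: (exists_norm1_neq (bar c)) => a ha hac.
have a0 : a != 0 by rewrite -norm_eq0 ha oner_eq0.
have hac1 : a * c != 1.
  by apply: contra_neq hac => h; rewrite -[LHS]mulr1 -hc mulrA h mul1r.
have hacN : a * c * bar (a * c) = 1 by rewrite rmorphM /= mulrACA ha hc mulr1.
have hac1' : bar (a * c) - 1 != 0 by rewrite -(rmorph1 bar) -rmorphB fmorph_eq0 subr_eq0.
exists (bar (a * c) - 1)^-1.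
  rewrite fmorphV rmorphB barK rmorph1 /=.
  have h : a * c - 1 != 0 by rewrite subr_eq0.
  move: (a * c) hac1' hacN h => b hb hN h.
  apply: (mulfI (mulf_neq0 h hb)).
  transitivity (b + bar b - 2); first by field; rewrite h hb.
  by transitivity (- (b * bar b) + b + bar b - 1); [rewrite hN|]; ring.
apply: (mulfI (chi_neq0 a0)); rewrite -bsum_rot // scale_col_mx scale_scalar_mx.
rewrite bsum_refl ?hdotZl ?hdotZr ?hz ?mulr0 ?addr0 //.
rewrite Psi_scale ha mulr1 mulrA -chiM; congr (chi _ * _).
by rewrite -{1}hacN -[X in _ - X]mulr1 -mulrBr mulfK.
Qed.

Lemma charsum0 : charsum 0 = 1.
Proof.
rewrite /charsum /Phi (eq_bigl (pred1 1%:M)) => [|g]; last first.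
  by rewrite !inE (flatmx0 (adj g *m g)) (flatmx0 1%:M) (flatmx0 g) !eqxx.
by rewrite big_pred1_eq det1 mulmx1 mxtrace1 lam0 chi1 mulr1.
Qed.

(** * Isotropic vectors *)

Definition col3 m k (p s : 'M[F]_(1, k)) (r : 'M[F]_(m, k)) : 'M[F]_(1 + (1 + m), k) :=
  col_mx p (col_mx s r).

(* The Gram matrix of a hyperbolic plane plus an orthonormal basis. *)
Definition hyp m : 'M[F]_(1 + (1 + m)) :=
  block_mx 0 (row_mx 1%:M 0) (col_mx 1%:M 0) (block_mx 0 0 0 1%:M).

Lemma mul_hyp_col3 m k (p s : 'M[F]_(1, k)) (r : 'M[F]_(m, k)) : hyp m *m col3 p s r = col3 s p r.
Proof.
rewrite /hyp /col3 mul_block_col mul_row_col mul_col_mx mul_block_col ?(mul1mx, mul0mx).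
by rewrite !addr0 !add0r add_col_mx addr0 add0r.
Qed.

Lemma hypK m : hyp m *m hyp m = 1%:M.
Proof.
rewrite /hyp mulmx_block mul_row_col mul_row_block mul_block_col mul_col_row mulmx_block.
rewrite ?(mulmx0, mul0mx, mulmx1, mul_mx_row, mul_col_mx) add_block_mx !addr0 !add0r.
by rewrite ?row_mx0 ?col_mx0 -!scalar_mx_block.
Qed.

Lemma adj_hyp m : adj (hyp m) = hyp m.
Proof. by rewrite /hyp !adj_block adj_row adj_col !adj0 !adj1. Qed.

Lemma adj_col3 m k (p s : 'M[F]_(1, k)) (r : 'M[F]_(m, k)) l (p' s' : 'M[F]_(1, l)) (r' : 'M[F]_(m, l)) :
  adj (col3 p s r) *m col3 p' s' r' = adj p *m p' + adj s *m s' + adj r *m r'.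
Proof. by rewrite /col3 !adj_col !mul_row_col addrA. Qed.

Definition hyp_unitary m : {set 'M[F]_(1 + (1 + m))} := [set g | adj g *m (hyp m *m g) == hyp m].

Lemma hyp_unitaryP m (g : 'M[F]_(1 + (1 + m))) :
  reflect (adj g *m (hyp m *m g) = hyp m) (g \in hyp_unitary m).
Proof. by rewrite inE; exact: eqP. Qed.

Lemma hyp_unitary_cols m (A B : 'cV_(1 + (1 + m))) (D : 'M[F]_(1 + (1 + m), m)) :
  reflect ([/\ adj A *m (hyp m *m A) = 0, adj A *m (hyp m *m B) = 1%:M, adj A *m (hyp m *m D) = 0,
    adj B *m (hyp m *m B) = 0 & adj B *m (hyp m *m D) = 0 /\ adj D *m (hyp m *m D) = 1%:M])
  (row_mx A (row_mx B D) \in hyp_unitary m).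
Proof.
have hs k l (X : 'M[F]_(1 + (1 + m), k)) (Y : 'M[F]_(_, l)) :
  adj X *m (hyp m *m Y) = adj (adj Y *m (hyp m *m X)).
  by rewrite !adjM adjK adj_hyp mulmxA.
have E : adj (row_mx A (row_mx B D)) *m (hyp m *m row_mx A (row_mx B D)) =
   block_mx (adj A *m (hyp m *m A)) (row_mx (adj A *m (hyp m *m B)) (adj A *m (hyp m *m D)))
     (col_mx (adj B *m (hyp m *m A)) (adj D *m (hyp m *m A)))
     (block_mx (adj B *m (hyp m *m B)) (adj B *m (hyp m *m D))
        (adj D *m (hyp m *m B)) (adj D *m (hyp m *m D))).
  by rewrite !adj_row !(mul_mx_row (hyp m)) !mul_col_row mul_mx_row (mul_col_mx (adj B)).
apply: (iffP idP) => [/hyp_unitaryP|[h1 h2 h3 h4 [h5 h6]]].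
  rewrite E /hyp => /eq_block_mx[-> /eq_row_mx[-> ->] _ /eq_block_mx[-> -> _ ->]].
  by split.
apply/hyp_unitaryP; rewrite E h1 h2 h3 h4 h5 h6 (hs _ _ B A) (hs _ _ D A) (hs _ _ D B).
by rewrite h2 h3 h5 adj1 !adj0.
Qed.

Lemma hyp_in m : hyp m \in hyp_unitary m.
Proof. by apply/hyp_unitaryP; rewrite adj_hyp hypK mulmx1. Qed.

Lemma hyp_unitary_mul m g h :
  g \in hyp_unitary m -> h \in hyp_unitary m -> g *m h \in hyp_unitary m.
Proof.
move=> /hyp_unitaryP hg /hyp_unitaryP hh; apply/hyp_unitaryP.
by rewrite adjM -!mulmxA (mulmxA (adj g)) (mulmxA _ g) -(mulmxA (adj g)) hg.
Qed.

Lemma hyp_unitary_unit m g : g \in hyp_unitary m -> g \in unitmx.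
Proof.
move=> /hyp_unitaryP hg; have : (hyp m *m adj g *m hyp m) *m g = 1%:M.
  by rewrite -!mulmxA hg hypK.
by case/mulmx1_unit.
Qed.

Lemma hyp_unitary_inv m g : g \in hyp_unitary m -> invmx g \in hyp_unitary m.
Proof.
move=> gU; have gu := hyp_unitary_unit gU; have /hyp_unitaryP hg := gU.
apply/hyp_unitaryP; rewrite -[in LHS]hg -!mulmxA mulmxV // mulmx1 mulmxA -adjM mulmxV //.
by rewrite adj1 mul1mx.
Qed.

(** As [hyp m] swaps the first two coordinates, this is the second coordinate of x. *)
Definition hbot m (x : 'cV[F]_(1 + (1 + m))) := hdot (evec (1 + m)) (hyp m *m x).

Definition hquad m (x : 'cV[F]_(1 + (1 + m))) := hdot x (hyp m *m x).

Lemma evecE m : evec (1 + m) = col3 1%:M 0 0.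
Proof. by rewrite /evec /col3 col_mx0. Qed.

Lemma hbot_col3 m p s (r : 'cV_m) : hbot (col3 p%:M s%:M r) = s.
Proof.
by rewrite /hbot mul_hyp_col3 /evec /col3 hdot_col hdot0l hdot_scalar rmorph1 mul1r addr0.
Qed.

Lemma hquad_col3 m p s (r : 'cV_m) :
  hquad (col3 p%:M s%:M r) = bar p * s + bar s * p + hdot r r.
Proof. by rewrite /hquad mul_hyp_col3 /col3 !hdot_col !hdot_scalar addrA. Qed.

Lemma hquad_unitary m g x : g \in hyp_unitary m -> hquad (g *m x) = hquad x.
Proof.
move=> /hyp_unitaryP hg; rewrite /hquad /hdot; congr (_ _ 0 0).
by rewrite adjM -!mulmxA (mulmxA (hyp m)) (mulmxA (adj g)) hg.
Qed.

Definition hweight m (g : 'M[F]_(1 + (1 + m))) := chi (\det g) * lam (\tr g).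

Definition hsum m (x : 'cV_(1 + (1 + m))) : C :=
  \sum_(g in hyp_unitary m | g *m evec (1 + m) == x) hweight g.

Lemma hsum_conj m h x : h \in hyp_unitary m -> h *m evec (1 + m) = evec (1 + m) ->
  hsum (h *m x) = hsum x.
Proof.
move=> hU he; have hu := hyp_unitary_unit hU.
have he' : invmx h *m evec (1 + m) = evec (1 + m) by rewrite -{1}he mulKmx.
rewrite /hsum (reindex (fun g => h *m g *m invmx h)) /=; last first.
  exists (fun g => invmx h *m g *m h) => g _; first by rewrite !mulmxA mulVmx // mul1mx mulmxKV.
  by rewrite !mulmxA mulmxV // mul1mx mulmxK.
apply: eq_big => g; last first.
  move=> _; rewrite /hweight !det_mulmx mulrAC -det_mulmx mulmxV // det1 mul1r.
  by rewrite mxtrace_mulC mulmxA mulVmx // mul1mx.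
congr (_ && _); last first.
  rewrite -!mulmxA he' (inj_eq (can_inj (mulKmx hu))) //.
apply/idP/idP => gU; last by rewrite !hyp_unitary_mul ?hyp_unitary_inv.
have := hyp_unitary_mul (hyp_unitary_mul (hyp_unitary_inv hU) gU) hU.
by rewrite !mulmxA mulVmx // mul1mx mulmxKV.
Qed.

(* The elements of [hyp_unitary m] mapping the first basis vector to [s] times the second. *)
Definition hcell m s t (y : 'cV[F]_m) (g : 'M[F]_m) : 'M[F]_(1 + (1 + m)) :=
  row_mx (col3 0 s%:M 0) (row_mx (col3 (bar s)^-1%:M t%:M y) (col3 0 (- s *: (adj y *m g)) g)).

Lemma hcell_unitary m s t (y : 'cV_m) g : s != 0 -> s^-1 * t + bar (s^-1 * t) + hdot y y = 0 ->
  g \in unitary m -> hcell s t y g \in hyp_unitary m.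
Proof.
move=> s_neq0 ht gU; have bs := bar_neq0 s_neq0.
apply/hyp_unitary_cols; rewrite !mul_hyp_col3 !adj_col3 !adj0 !adj_scalar.
rewrite ?(mulmx0, mul0mx) ?addr0 ?add0r -!scalar_mxM hdotE (unitaryP _ gU).
split=> //; first by rewrite mulfV.
  rewrite -!raddfD /= -[RHS](raddf0 scalar_mx); congr _%:M.
  by rewrite -ht rmorphM !fmorphV /= barK [_ * bar t]mulrC.
split=> //; rewrite mul_scalar_mx scalerA fmorphV barK mulrN mulVf // scaleN1r.
by rewrite addNr.
Qed.

(** In the Gram equations, pairing the first column with the others fixes their top entries, and
    pairing the second with the last block gives that block's second row. What remains is the trace
    condition on t and the unitarity of g. *)
Lemma hcell_shape m s (h : 'M[F]_(1 + (1 + m))) : s != 0 -> h \in hyp_unitary m ->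
  h *m evec (1 + m) = col3 0 s%:M 0 ->
  exists t y g, [/\ h = hcell s t y g, s^-1 * t + bar (s^-1 * t) + hdot y y = 0 & g \in unitary m].
Proof.
move=> s_neq0 hU; have bs := bar_neq0 s_neq0; move: hU.
rewrite -[h]hsubmxK -[rsubmx h]hsubmxK.
move: (lsubmx h) (lsubmx (rsubmx h)) (rsubmx (rsubmx h)) => A B D hU.
rewrite /evec mul_row_col mulmx1 mulmx0 addr0 => hA; move: hU; rewrite hA {A hA}.
rewrite -[B]vsubmxK -[dsubmx B]vsubmxK -[D]vsubmxK -[dsubmx D]vsubmxK.
move: (usubmx B) (usubmx (dsubmx B)) (dsubmx (dsubmx B)) => al t y.
move: (usubmx D) (usubmx (dsubmx D)) (dsubmx (dsubmx D)) => be rho g.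
rewrite -[col_mx al _]/(col3 al t y) -[col_mx be _]/(col3 be rho g).
rewrite [al]mx11_scalar [t]mx11_scalar; move: (al 0 0) (t 0 0) => {}al {}t.
move=> /hyp_unitary_cols[_]; rewrite !mul_hyp_col3 !adj_col3 !adj0 !adj_scalar.
rewrite ?(mulmx0, mul0mx) ?addr0 ?add0r -!scalar_mxM hdotE => h1 h2 h3 [h4 h5].
have hal : al = (bar s)^-1.
  have := congr1 (fun M : 'M[F]_1 => M 0 0) h1; rewrite !mxE !eqxx !mulr1n => hal.
  by apply: (mulfI bs); rewrite hal mulfV.
have hbe : be = 0.
  by move: h2; rewrite mul_scalar_mx => /eqP; rewrite scaler_eq0 (negPf bs) => /eqP.
move: h3 h4 h5; rewrite hal hbe adj0 fmorphV barK ?(mulmx0, mul0mx) ?addr0 ?add0r => h3 h4 h5.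
exists t, y, g; split; last exact/unitaryP.
  rewrite /hcell; congr (row_mx _ (row_mx _ (col3 _ _ _))).
  have : s *: (s^-1%:M *m rho + adj y *m g) = 0 by rewrite h4 scaler0.
  rewrite scalerDr mul_scalar_mx scalerA divff // scale1r => /eqP.
  by rewrite addr_eq0 -scaleNr => /eqP.
have := congr1 (fun M : 'M[F]_1 => M 0 0) h3; rewrite !mxE !eqxx !mulr1n => <-.
by rewrite rmorphM fmorphV /= mulrC [bar t * _]mulrC.
Qed.

Lemma hcell_block m s t (y : 'cV_m) g :
  hcell s t y g = block_mx 0 (row_mx (bar s)^-1%:M 0) (col_mx s%:M 0)
                    (block_mx t%:M (- s *: (adj y *m g)) y g).
Proof.
rewrite /hcell /col3 [RHS]block_mxEh; congr row_mx; rewrite block_mxEh.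
by rewrite -!block_mxEh block_mxEv -block_mxEh.
Qed.

Lemma tr_hcell m s t (y : 'cV_m) g : \tr (hcell s t y g) = t + \tr g.
Proof.
by rewrite hcell_block !mxtrace_block mxtrace0 add0r mxtrace_scalar mulr1n.
Qed.

Lemma det_hyp m : \det (hyp m) = -1.
Proof.
(* Swapping two basis vectors is the reflection in their difference; in this form it needs no
   division by 2. *)
have -> : hyp m = refl (col3 1%:M (- 1%:M) 0) (-1).
  rewrite /refl /hyp /col3 adj_col adj_col adj0 adj1 -!scaleN1r adjZ adj1 rmorphN1 mul_col_row.
  rewrite mul_mx_row mul_col_mx mul_col_row ?(mulmx0, mul0mx, mulmx1, mul1mx).
  rewrite -scalemxAl mul1mx scalerA mulrNN mulr1 scale1r.
  rewrite [1%:M in RHS]scalar_mx_block [X in _ = block_mx _ _ _ X + _]scalar_mx_block.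
  rewrite !(scale_block_mx, scale_row_mx, scale_col_mx) !add_block_mx.
  by rewrite !scaler0 !scaleN1r !add0r !opprK !addr0 !subrr.
rewrite refl_det /col3 !hdot_col hdot0r -scaleN1r hdotZl hdotZr.
by rewrite -[1%:M]/((1%:M : 'M[F]_1)) hdot_scalar rmorphN1 rmorph1; ring.
Qed.

Lemma det_hcell m s t (y : 'cV_m) g : s != 0 -> \det (hcell s t y g) = - (s / bar s) * \det g.
Proof.
move=> s_neq0.
have -> : hcell s t y g = hyp m *m row_mx (col3 s%:M 0 0)
    (row_mx (col3 t%:M (bar s)^-1%:M y) (col3 (- s *: (adj y *m g)) 0 g)).
  by rewrite !(mul_mx_row (hyp m)) !mul_hyp_col3.
rewrite det_mulmx det_hyp mulN1r mulNr; congr (- _).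
have -> : row_mx (col3 s%:M 0 0)
    (row_mx (col3 t%:M (bar s)^-1%:M y) (col3 (- s *: (adj y *m g)) 0 g)) =
  block_mx s%:M (row_mx t%:M (- s *: (adj y *m g))) 0 (block_mx (bar s)^-1%:M 0 y g).
  rewrite /col3 [RHS]block_mxEh col_mx0; congr row_mx; rewrite -block_mxEh block_mxEv.
  by rewrite -block_mxEh.
by rewrite det_ublock det_lblock !det_scalar1 mulrA.
Qed.

Definition hcellK m (h : 'M[F]_(1 + (1 + m))) : ('cV[F]_m * F) * 'M[F]_m :=
  ((dsubmx (dsubmx (lsubmx (rsubmx h))), usubmx (dsubmx (lsubmx (rsubmx h))) 0 0),
   dsubmx (dsubmx (rsubmx (rsubmx h)))).

Lemma hcell_evec m s t (y : 'cV_m) g : hcell s t y g *m evec (1 + m) = col3 0 s%:M 0.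
Proof. by rewrite /hcell /evec mul_row_col mulmx1 mulmx0 addr0. Qed.

(** The fibre is parametrized bijectively by y, t and g, and both determinant and trace separate g
    from y and t. *)
Lemma hsum_cell m s : s != 0 -> hsum (col3 0 s%:M (0 : 'cV_m)) =
  chi (- (s / bar s)) * charsum m *
  \sum_(y : 'cV_m) \sum_(t | s^-1 * t + bar (s^-1 * t) + hdot y y == 0) lam t.
Proof.
move=> s_neq0.
have K t (y : 'cV_m) g : hcellK (hcell s t y g) = ((y, t), g).
  by rewrite /hcellK /hcell /col3 row_mxKr row_mxKl row_mxKr !col_mxKd col_mxKu mxE eqxx mulr1n.
pose cond (p : 'cV_m * F * 'M[F]_m) :=
  (s^-1 * p.1.2 + bar (s^-1 * p.1.2) + hdot p.1.1 p.1.1 == 0) && (p.2 \in unitary m).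
transitivity (\sum_(p | cond p) hweight (hcell s p.1.2 p.1.1 p.2)).
  rewrite /hsum (reindex_onto (fun p => hcell s p.1.2 p.1.1 p.2) (@hcellK m)) /=.
    apply: eq_bigl => -[[y t] g]; rewrite K eqxx andbT hcell_evec eqxx andbT /cond /=.
    apply/idP/andP => [hU|[/eqP ht gU]]; last exact: hcell_unitary.
    have [t' [y' [g' [/(congr1 (@hcellK m))]]]] := hcell_shape s_neq0 hU (hcell_evec _ _ _ _).
    by rewrite !K => -[-> -> ->] -> ->.
  move=> h /andP[hU /eqP he]; have [t [y [g [-> _ _]]]] := hcell_shape s_neq0 hU he.
  by have := K t y g; rewrite /hcellK => -[-> -> ->].
rewrite pair_big_dep /= -mulrA /charsum /Phi big_distrlr /= exchange_big /= pair_big /=.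
rewrite big_distrr /=; apply: eq_big => -[[y t] g] //= _.
by rewrite /hweight det_hcell // tr_hcell chiM lamD mul1mx; ring.
Qed.

(** The element [hyp m *m c] built in the proof fixes the first basis vector and takes s times the
    second one to x, so [hsum_conj] applies. *)
Lemma hsum_bot m (x : 'cV_(1 + (1 + m))) : hquad x = 0 -> hbot x != 0 ->
  hsum x = hsum (col3 0 (hbot x)%:M (0 : 'cV_m)).
Proof.
rewrite -[x]vsubmxK -[dsubmx x]vsubmxK; move: (usubmx x) (usubmx (dsubmx x)) (dsubmx (dsubmx x)).
move=> p s r; rewrite [p]mx11_scalar [s]mx11_scalar -/(col3 _ _ _).
move: (p 0 0) (s 0 0) => {}p {}s; rewrite hbot_col3 hquad_col3 => hx s_neq0.
have bs := bar_neq0 s_neq0.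
pose c := hcell 1 (s^-1 * p) (s^-1 *: r) 1%:M.
have cU : c \in hyp_unitary m.
  apply: hcell_unitary (unitary1 _); first exact: oner_neq0.
  rewrite invr1 mul1r hdotZl hdotZr rmorphM !fmorphV /=.
  transitivity ((s * bar s)^-1 * (bar p * s + bar s * p + hdot r r)); last by rewrite hx mulr0.
  by field; rewrite s_neq0 bs.
rewrite -(@hsum_conj _ (hyp m *m c) (col3 0 s%:M 0)) ?hyp_unitary_mul ?hyp_in //; last first.
  by rewrite -mulmxA hcell_evec mul_hyp_col3 evecE.
congr hsum; rewrite -mulmxA.
have -> : c *m col3 0 s%:M 0 = col3 s%:M p%:M r.
  rewrite /c /hcell /col3 !mul_row_col !mulmx0 add0r addr0 mul_mx_scalar rmorph1 invr1.
  by rewrite !scale_col_mx !scale_scalar_mx mulr1 scalerA mulVKf // divff // scale1r.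
by rewrite mul_hyp_col3.
Qed.

Lemma sum_cell m v : v != 0 ->
  \sum_(y : 'cV_m) \sum_(t | (s0 * v)^-1 * t + bar ((s0 * v)^-1 * t) + hdot y y == 0) lam t =
  if bar v == v then q%:R * Q ^+ m else 0.
Proof.
move=> v0; have sv : s0 * v != 0 by rewrite mulf_neq0.
(* With w of trace 1, [- w * hdot y y] is one element of trace [- hdot y y]. Substituting t = s0 v r
   turns the inner sum into a sum of psi over the trace fibre of that element. *)
case: (exists_trace (rmorph1 bar)) => w hw.
transitivity (\sum_(y : 'cV_m)
   \sum_(r | r + bar r == - w * hdot y y + bar (- w * hdot y y)) psi (v * r)).
  apply: eq_bigr => y _; rewrite (reindex_inj (mulfI sv)); apply: eq_big => r.
    rewrite mulKf // rmorphM /= hdotC rmorphN -mulrDl -opprD hw mulN1r.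
    by rewrite -[in RHS]subr_eq0 opprK.
  by rewrite /psi mulrA.
under eq_bigr do rewrite sum_psi_trace_fiber.
case: eqP => [hv|_]; last by rewrite big1.
rewrite -big_distrr /= -(@sum_psi_hdot m (v * - w)).
  by congr (_ * _); apply: eq_bigr => y _; rewrite mulrA.
by rewrite rmorphM rmorphN /= hv -mulrDr -opprD hw mulrN1 oppr_eq0.
Qed.

Lemma sum_fiber_bot m s : s != 0 ->
  \sum_p \sum_(r : 'cV_m) (if bar p * s + bar s * p + hdot r r == 0 then 1 else 0) =
  q%:R ^+ (2 * m).+1 :> C.
Proof.
move=> s_neq0; have bs := bar_neq0 s_neq0.
rewrite exchange_big /=; transitivity (\sum_(r : 'cV[F]_m) (q%:R : C)); last first.
  by rewrite sumr_const card_mx cardF muln1 -expnM -[_ *+ (q ^ _)]mulr_natr natrX -exprS.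
apply: eq_bigr => r _; rewrite -big_mkcond (reindex_inj (mulfI (invr_neq0 bs))) /=.
rewrite sumr_const -[X in _ *+ X]/#|[pred p : F | _]| -(card_trace (r := - hdot r r)).
  congr (_ *+ _); apply: eq_card => p; rewrite !inE rmorphM fmorphV barK.
  rewrite mulrAC mulVf // mul1r mulVKf // [p + _]addrC.
  exact: addr_eq0.
by rewrite rmorphN /= hdotC.
Qed.

(** The factor 1 - lam vanishes where [hbot] does, so only the big cell counts, and there [hsum]
    depends on s = [hbot] alone. Writing s = s0 v, only v fixed by [bar] survive, and a factor q
    together with [chi (- s0 / bar s0)] makes up [g2]. *)
Lemma sum_hyp m a : a + bar a != 0 ->
  \sum_(h in hyp_unitary m) hweight h * (1 - lam (a * hbot (h *m evec (1 + m)))) =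
  q%:R ^+ (2 * m + 2) * Q ^+ m * g2 * charsum m.
Proof.
move=> ha.
rewrite (partition_big (fun h => h *m evec (1 + m)) (fun x => hquad x == 0)) /=; last first.
  move=> h hU; rewrite hquad_unitary // evecE -(raddf0 scalar_mx) hquad_col3.
  by rewrite rmorph1 rmorph0 mulr0 mul0r hdot0r !addr0.
pose K s := hsum (col3 0 s%:M (0 : 'cV_m)).
transitivity (\sum_(x : 'cV_(1 + (1 + m)) | hquad x == 0) (1 - lam (a * hbot x)) * K (hbot x)).
  apply: eq_bigr => x /eqP hx; transitivity ((1 - lam (a * hbot x)) * hsum x).
    by rewrite big_distrr /=; apply: eq_bigr => h /andP[_ /eqP <-]; rewrite mulrC.
  have [->|h0] := eqVneq (hbot x) 0; first by rewrite mulr0 lam0 subrr !mul0r.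
  by rewrite hsum_bot.
rewrite big_mkcond sum_cV_S.
transitivity (\sum_s (1 - lam (a * s)) * K s *
   \sum_p \sum_(r : 'cV_m) (if bar p * s + bar s * p + hdot r r == 0 then 1 else 0)).
  under eq_bigr do rewrite sum_cV_S.
  rewrite exchange_big /=; apply: eq_bigr => s _; rewrite big_distrr; apply: eq_bigr => p _.
  rewrite big_distrr; apply: eq_bigr => r _ /=; rewrite -/(col3 _ _ _) hquad_col3 hbot_col3.
  by case: eqP; rewrite ?mulr1 ?mulr0.
transitivity (q%:R ^+ (2 * m).+1 * \sum_s (1 - lam (a * s)) * K s).
  rewrite big_distrr; apply: eq_bigr => s _ /=.
  have [->|s_neq0] := eqVneq s 0; first by rewrite mulr0 lam0 subrr !mul0r mulr0.
  by rewrite sum_fiber_bot // mulrC.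
rewrite (reindex_inj (mulfI s0_neq0)) /=.
transitivity (q%:R ^+ (2 * m).+1 * \sum_(v | bar v == v) (1 - psi (a * v)) *
   (g2 * charsum m * Q ^+ m)).
  congr (_ * _); rewrite [RHS]big_mkcond; apply: eq_bigr => v _.
  have [->|v0] := eqVneq v 0.
    by rewrite /psi !mulr0 lam0 subrr !mul0r; case: ifP.
  have sv : s0 * v != 0 by rewrite mulf_neq0.
  rewrite /K hsum_cell // sum_cell //; case: eqP => [hv|]; last by rewrite !mulr0.
  rewrite rmorphM /= hv g2E /psi [s0 * (a * v)]mulrCA.
  have -> : s0 * v / (bar s0 * v) = s0 / bar s0.
    by field; rewrite v0 bar_neq0.
  by rewrite mulNr; ring.
have hq : \sum_(v | bar v == v) (1 : C) = q%:R.
  by rewrite sumr_const -[X in _ *+ X]/#|[pred v : F | bar v == v]| card_fix.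
rewrite -big_distrl /= big_split /= sumrN (sum_psi_fix ha) subr0 hq addn2 [in RHS]exprS.
by ring.
Qed.

Lemma exists_hyp_frame m th : th * bar th = -1 ->
  exists2 T : 'M[F]_(1 + (1 + m)), adj T *m T = hyp m & T *m evec (1 + m) = col3 1%:M th%:M 0.
Proof.
move=> hth; case: (exists_trace (rmorph1 bar)) => w hw.
(* The first column is isotropic since th has norm -1; w of trace 1 makes the second isotropic with
   product 1 with the first. *)
exists (row_mx (col3 1%:M th%:M 0)
  (row_mx (col3 w%:M (- th * (1 - w))%:M 0) (col3 0 0 1%:M))); last first.
  by rewrite /evec mul_row_col mulmx1 mulmx0 addr0.
have hw' : bar w = 1 - w by rewrite -hw addrC addKr.
have hth' : bar th * th = -1 by rewrite mulrC.
have sc a : a = 0 -> a%:M = 0 :> 'M[F]_1 by move=> ->; rewrite raddf0.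
have bw : bar (- th * (1 - w)) = - bar th * w.
  by rewrite rmorphM rmorphN rmorphB rmorph1 /= hw' opprB addrC subrK.
rewrite !adj_row mul_col_row (mul_mx_row (adj _)) (mul_col_mx (adj _)) mul_col_row !adj_col3.
rewrite !adj0 !adj_scalar ?(mulmx0, mul0mx, adj1, mulmx1, mul1mx) ?addr0 ?add0r -?scalar_mxM.
rewrite bw hw' rmorph1 -!raddfD /= /hyp; congr block_mx; last congr block_mx.
- by apply: sc; rewrite hth' addrN.
- congr (row_mx _%:M _); rewrite mulrA mulrN hth'; ring.
- congr (col_mx _%:M _); rewrite mulrAC mulNr hth'; ring.
- apply: sc; transitivity ((1 - w) * w * (1 + bar th * th)); first by ring.
  by rewrite hth' subrr mulr0.
Qed.

(** Conjugation by T carries one form to the other, and <z, g z> for z = T e becomes the second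
    coordinate of h e. *)
Lemma Psi_frame m (T : 'M[F]_(1 + (1 + m))) a : adj T *m T = hyp m ->
  Psi a (T *m evec (1 + m)) =
  \sum_(h in hyp_unitary m) hweight h * lam (a * hbot (h *m evec (1 + m))).
Proof.
move=> hT.
have TL : (hyp m *m adj T) *m T = 1%:M by rewrite -mulmxA hT hypK.
have [_ Tu] := mulmx1_unit TL.
rewrite /Psi /Phi (reindex (fun h => T *m h *m invmx T)) /=; last first.
  exists (fun h => invmx T *m h *m T) => g _; first by rewrite !mulmxA mulVmx // mul1mx mulmxKV.
  by rewrite !mulmxA mulmxV // mul1mx mulmxK.
have hh h : adj T *m (adj (T *m h *m invmx T) *m (T *m h *m invmx T)) *m T = adj h *m (hyp m *m h).
  by rewrite mulmxA -adjM -mulmxA mulmxKV // adjM -hT !mulmxA.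
apply: eq_big => h.
  apply/unitaryP/hyp_unitaryP => e; first by rewrite -hh e mulmx1 hT.
  have := congr1 (fun M => adj (invmx T) *m M *m invmx T) (hh h).
  rewrite e -[in RHS]hT !mulmxA -[in RHS]adjM -[adj (invmx T) *m adj T]adjM !mulmxV // adj1.
  by rewrite !mul1mx mulmxV // !mulmxK.
move=> _; rewrite /hweight !det_mulmx mulrAC -det_mulmx mulmxV // det1 mul1r -mulrA -lamD.
congr (_ * lam _); rewrite mulmxDl mul1mx mxtraceD; congr (_ + _).
  by rewrite mxtrace_mulC mulmxA mulVmx // mul1mx.
rewrite -scalemxAl mxtraceZ adjM; congr (_ * _).
rewrite -!mulmxA mxtrace_mulC -!mulmxA.
rewrite mulVmx // mulmx1 (mulmxA (adj T)) hT mxtrace_mulC -!mulmxA hdotE.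
by rewrite mxtrace_scalar mulr1n.
Qed.

Lemma isotropic_normal_form m (z : 'cV_(1 + (1 + m))) : z != 0 -> hdot z z = 0 ->
  exists c th U, [/\ c != 0, th * bar th = -1, U \in unitary (1 + (1 + m)) &
    U *m z = c *: col3 1%:M th%:M 0].
Proof.
move=> z0 hz.
(* V takes a coordinate vector at which z is nonzero to the first basis vector. *)
have [V VU hV] : exists2 V, V \in unitary (1 + (1 + m)) & usubmx (V *m z) 0 0 != 0.
  case/cV0Pn: z0 => i hi; pose d : 'cV[F]_(1 + (1 + m)) := delta_mx i 0.
  have hd x : hdot d x = x i 0.
    rewrite /hdot mxE (bigD1 i) //= big1 => [|j ji]; rewrite !mxE ?eqxx.
      by rewrite rmorph1 mul1r addr0.
    by rewrite (negPf ji) rmorph0 mul0r.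
  have hdd : hdot d d = 1 by rewrite hd mxE !eqxx.
  case: (exists_unitary_evec hdd) => R RU hR.
  exists (adj R); first exact: unitary_adj.
  rewrite -hdot_evecl -(hdot_unitary _ _ RU) hR mulmxA unitary_adjr // mul1mx hd.
  exact: hi.
set x := V *m z in hV.
have hx : hdot x x = 0 by rewrite hdot_unitary.
case: (exists_norm (r := -1)) => [||th th0 hth].
- by rewrite rmorphN1.
- by rewrite oppr_eq0 oner_eq0.
have bth := bar_neq0 th0.
pose c := usubmx x 0 0; have bc : bar c != 0 by rewrite bar_neq0.
have ex : x = col_mx c%:M (dsubmx x) by rewrite /c -mx11_scalar vsubmxK.
(* Isotropy of x gives [dsubmx x] the norm - c bar c, and th has norm -1, so w is a unit vector. *)
pose w := (th * c)^-1 *: dsubmx x.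
have hw : hdot w w = 1.
  have := hx; rewrite ex hdot_col hdot_scalar => /eqP; rewrite addrC addr_eq0 => /eqP h.
  rewrite /w hdotZl hdotZr h fmorphV rmorphM /=.
  transitivity (- (th * bar th)^-1); first by field; rewrite bth th0 bc hV.
  by rewrite hth invrN1 opprK.
case: (exists_unitary_evec hw) => R RU hR.
exists c, th, (adj (lift1 R) *m V); split => //.
  by rewrite unitary_mul // unitary_adj // lift1_unitary.
have -> : (adj (lift1 R) *m V) *m z = adj (lift1 R) *m x by rewrite mulmxA.
have -> : x = lift1 R *m (c *: col3 1%:M th%:M 0).
  rewrite -scalemxAr /lift1 /col3 mul_block_col !mul0mx mul1mx addr0 add0r.
  have -> : col_mx th%:M 0 = th *: evec m.
    by rewrite /evec scale_col_mx scale_scalar_mx mulr1 scaler0.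
  rewrite -scalemxAr hR scale_col_mx scale_scalar_mx mulr1 /w !scalerA.
  by rewrite [c * th]mulrC mulfV ?mulf_neq0 // scale1r.
by rewrite mulmxA (unitaryP (lift1 R) _) ?mul1mx // lift1_unitary.
Qed.

Lemma Psi_isotropic m (z : 'cV_(1 + (1 + m))) a : z != 0 -> hdot z z = 0 -> a + bar a != 0 ->
  Psi a z = charsum (1 + (1 + m)) - q%:R ^+ (2 * m + 2) * Q ^+ m * g2 * charsum m.
Proof.
move=> z0 hz ha; case: (isotropic_normal_form z0 hz) => c [th [U [c0 hth UU hU]]].
have bc := bar_neq0 c0.
case: (exists_hyp_frame m hth) => T hT hTe.
rewrite -(Psi_conj a z UU) hU Psi_scale -hTe Psi_frame // -(sum_hyp m (a := a * (c * bar c))).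
  rewrite /charsum -(Psi_a0 (T *m evec (1 + m))) Psi_frame // -sumrB; apply: eq_bigr => h _.
  by rewrite mul0r lam0; ring.
by rewrite rmorphM norm_fix -mulrDl mulf_neq0 // mulf_neq0.
Qed.

(** * The recursion *)

(* The difference between [charsum n] and the sum twisted by an isotropic vector; such
   vectors only exist for [n >= 2]. *)
Definition defect n : C :=
  if n is m.+2 then q%:R ^+ (2 * m + 2) * Q ^+ m * g2 * charsum m else 0.

Lemma Psi_isotropic_defect n (z : 'cV_n) a : z != 0 -> hdot z z = 0 -> a + bar a != 0 ->
  Psi a z = charsum n - defect n.
Proof.
case: n z => [|[|m]] z z0 hz ha.
- by rewrite (flatmx0 z) eqxx in z0.
- rewrite [z]mx11_scalar hdot_scalar in hz.
  have /eqP := hz; rewrite mulrC norm_eq0 => /eqP h.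
  by rewrite [z]mx11_scalar h raddf0 eqxx in z0.
- exact: Psi_isotropic.
Qed.

(* [fprev 0] is multiplied by [cnt 0 1 = 0] wherever it occurs. *)
Definition fprev n k : C := if n is m.+1 then fsum m k else 0.

(** Up to chi c, the surplus at a norm-one c over the term [cnt n 1 * fprev n (bar c)] that is exact
    for all other c: z = 0 gives [charsum n], each other isotropic z gives [charsum n - defect n],
    and [cnt n 0 - cnt n 1] is [Q ^+ n]. *)
Definition residue n : C := Q ^+ n * charsum n - (cnt n 0 - 1) * defect n.

Lemma fprev_norm1 n k c : c * bar c = 1 -> fprev n (k * c) = (chi c)^-1 * fprev n k.
Proof. by case: n => [|m] hc /=; [rewrite mulr0 | exact: fsum_norm1]. Qed.

Lemma cnt_neq0 n v : bar v = v -> v != 0 -> cnt n v = cnt n 1.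
Proof.
move=> hv v0; apply: (mulfI q_neq0); rewrite !cntE ?rmorph1 //.
by rewrite (negPf v0) oner_eq0.
Qed.

Lemma cnt_0_1 n : cnt n 0 = cnt n 1 + Q ^+ n.
Proof.
apply: (mulfI q_neq0); rewrite mulrDr !cntE ?rmorph1 ?rmorph0 // eqxx oner_eq0.
by rewrite mul1r !mul0r addr0.
Qed.

Lemma cnt_dim0 : cnt 0 1 = 0.
Proof.
by apply: (mulfI q_neq0); rewrite cntE ?rmorph1 // oner_eq0 muln0 subrr !mul0r addr0 mulr0.
Qed.

Lemma cnt1_fprev n : cnt n 1 * fprev n 1 = cnt n 1 * charsum n.
Proof. by case: n => [|m]; rewrite ?cnt_dim0 ?mul0r // /fprev fsum1. Qed.

Lemma sum_bsum n c :
  \sum_(z : 'cV_n | c * bar c + hdot z z == 1) bsum (col_mx c%:M z) =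
  cnt n 1 * fprev n (bar c) + (if c * bar c == 1 then residue n * chi c else 0).
Proof.
have [hc|hc] := eqVneq (c * bar c) 1.
  rewrite (eq_bigl (fun z => hdot z z == 0)) => [|z]; last first.
    by rewrite hc -subr_eq0 addrAC subrr add0r.
  have h0 : \sum_(z : 'cV_n | (hdot z z == 0) && (z != 0)) bsum (col_mx c%:M z) =
      (cnt n 0 - 1) * (chi c * (charsum n - defect n)).
    transitivity (\sum_(z : 'cV_n | (hdot z z == 0) && (z != 0)) chi c * (charsum n - defect n)).
      apply: eq_bigr => z /andP[/eqP hz z0].
      have [t ht ->] := bsum_isotropic hc hz; rewrite Psi_isotropic_defect // ht.
      by rewrite oppr_eq0 oner_eq0.
    have -> : cnt n 0 - 1 = \sum_(z : 'cV_n | (hdot z z == 0) && (z != 0)) 1.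
      by rewrite /cnt (bigD1 (0 : 'cV_n)) ?hdot0r //= addrAC subrr add0r.
    by rewrite big_distrl /=; apply: eq_bigr => z _; rewrite mul1r.
  rewrite (bigD1 (0 : 'cV_n)) ?hdot0r //= h0.
  have [t ht ->] := bsum_isotropic hc (hdot0r (0 : 'cV_n)).
  have -> : fprev n (bar c) = chi c * fprev n 1.
    have c0 : c != 0 by rewrite -norm_eq0 hc oner_eq0.
    have hb : bar c = c^-1 by apply: (mulfI c0); rewrite hc mulfV.
    rewrite -[bar c]mul1r fprev_norm1; last by rewrite barK mulrC.
    by rewrite hb chiV invrK.
  rewrite Psi_z0 -/(charsum n) [cnt n 1 * (_ * _)]mulrCA cnt1_fprev /residue cnt_0_1; ring.
rewrite addr0 (eq_bigl (fun z => hdot z z == 1 - c * bar c)) => [|z]; last first.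
  by apply/eqP/eqP => [<-|->]; ring.
have hv : bar (1 - c * bar c) = 1 - c * bar c by rewrite rmorphB rmorph1 norm_fix.
have v0 : 1 - c * bar c != 0 by rewrite subr_eq0 eq_sym.
rewrite -(cnt_neq0 n hv v0) [in RHS]mulrC /cnt big_distrr /=; apply: eq_bigr => z /eqP hz.
rewrite mulr1; case: n z hz => [|m] z hz.
  by move: v0; rewrite -hz (flatmx0 z) hdot0r eqxx.
by rewrite bsum_generic ?hz // addrC subrK.
Qed.

Lemma fsum_rec n k : fsum n k = cnt n 1 * \sum_c lam (k * c) * fprev n (bar c) +
  residue n * \sum_(c | c * bar c == 1) lam (k * c) * chi c.
Proof.
rewrite fsum_bsum big_mkcond sum_cV_S.
transitivity (\sum_c lam (k * c) *
    \sum_(z : 'cV_n | c * bar c + hdot z z == 1) bsum (col_mx c%:M z)).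
  apply: eq_bigr => c _; rewrite -big_mkcond big_distrr /=; apply: eq_big => z.
    by rewrite hdot_col hdot_scalar [bar c * c]mulrC.
  by move=> _; rewrite /evec hdot_col hdot0l hdot_scalar rmorph1 mul1r addr0.
under eq_bigr do rewrite sum_bsum mulrDr.
rewrite big_split /= !big_distrr /= [X in _ = _ + X]big_mkcond /=; congr (_ + _); apply: eq_bigr => c _.
  by rewrite mulrCA.
by case: eqP => _; rewrite ?mulr0 // mulrCA.
Qed.

(** Invariance of psi under [bar] makes [lam (bar c * d)] an additive character in c with parameter
    [s0 / bar s0 * bar d]. Orthogonality leaves the one d for which it cancels [lam c]. *)
Lemma lam_transform_sq (phi : F -> C) :
  \sum_c lam c * \sum_d lam (bar c * d) * phi d = (q ^ 2)%:R * phi (- s0 / bar s0).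
Proof.
have bs := bar_neq0 s0_neq0.
transitivity (\sum_d phi d * \sum_c lam ((1 + s0 / bar s0 * bar d) * c)).
  under eq_bigr do rewrite big_distrr /=.
  rewrite exchange_big /=; apply: eq_bigr => d _; rewrite big_distrr; apply: eq_bigr => c _ /=.
  rewrite mulrA mulrC; congr (_ * _); rewrite mulrDl mul1r lamD; congr (_ * _).
  transitivity (psi (bar c * d / s0)); first by rewrite /psi [s0 * _]mulrC divfK.
  rewrite -psi_bar fmorph_div rmorphM barK /psi; congr lam; ring.
rewrite (bigD1 (- s0 / bar s0)) //= [X in _ + X]big1 => [|d hd].
  rewrite addr0 mulrC sum_lam fmorph_div rmorphN barK.
  have -> : 1 + s0 / bar s0 * (- bar s0 / s0) = 0 by field; rewrite s0_neq0 bs.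
  by rewrite eqxx.
rewrite sum_lam ifN ?mulr0 //; apply: contra_neq hd => h.
apply: (fmorph_inj bar); rewrite fmorph_div rmorphN barK.
have -> : bar d = (1 + s0 / bar s0 * bar d - 1) * (bar s0 / s0) by field; rewrite s0_neq0 bs.
by rewrite h sub0r mulN1r mulNr.
Qed.

Lemma charsum1 : charsum 1 = g1.
Proof.
rewrite -[1%N]/(1 + 0)%N -fsum1 fsum_rec cnt_dim0 mul0r add0r g1E.
rewrite /residue /defect mulr0 subr0 expr0 charsum0 !mul1r.
by apply: eq_bigr => c _; rewrite mul1r mulrC.
Qed.

(** Apply [fsum_rec] at k = 1 and again to the inner [fprev]. The squared transform evaluates at a
    point of norm one, where the residue term survives and q^2 times chi is q times [g2]. *)
Lemma charsum_rec n : charsum n.+2 =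
  cnt n.+1 1 * (q%:R * g2 * (cnt n 1 * charsum n + residue n)) + residue n.+1 * g1.
Proof.
rewrite -[n.+2]/(1 + n.+1)%N -fsum1 fsum_rec; congr (_ * _ + _ * _); last first.
  by rewrite g1E; apply: eq_bigr => c _; rewrite mul1r mulrC.
pose phi d := cnt n 1 * fprev n (bar d) + residue n * (if d * bar d == 1 then chi d else 0).
transitivity (\sum_c lam c * \sum_d lam (bar c * d) * phi d).
  apply: eq_bigr => c _; rewrite mul1r /= fsum_rec; congr (_ * _).
  rewrite !big_distrr /= [X in _ + X]big_mkcond -big_split /=; apply: eq_bigr => d _.
  by rewrite /phi; case: eqP => _; ring.
have bs := bar_neq0 s0_neq0.
have hs : - s0 / bar s0 * bar (- s0 / bar s0) = 1.
  by rewrite fmorph_div rmorphN barK; field; rewrite s0_neq0 bs.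
rewrite lam_transform_sq /phi hs eqxx g2E -[bar _]mul1r fprev_norm1; last by rewrite barK mulrC.
have -> : (chi (bar (- s0 / bar s0)))^-1 = chi (- s0 / bar s0).
  by rewrite -chiV; congr chi; rewrite -[LHS]mul1r -hs mulfK // fmorph_eq0 mulf_neq0 ?oppr_eq0 ?invr_eq0.
rewrite mulrCA cnt1_fprev natrX; ring.
Qed.

Lemma charsum_three_term n : charsum n.+2 = Q ^+ n.+1 * g1 * charsum n.+1 +
  Q ^+ n.*2.+1 * (Q ^+ n.+1 - 1) * g2 * charsum n.
Proof.
(* The instance for n + 2 needs the one for n, so two consecutive instances are carried through the
   induction. *)
suff: charsum n.+2 = Q ^+ n.+1 * g1 * charsum n.+1 +
        Q ^+ n.*2.+1 * (Q ^+ n.+1 - 1) * g2 * charsum n /\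
      charsum n.+3 = Q ^+ n.+2 * g1 * charsum n.+2 +
        Q ^+ n.+1.*2.+1 * (Q ^+ n.+2 - 1) * g2 * charsum n.+1 by case.
have q0 := q_neq0.
have c1 m : cnt m 1 = ((Q ^+ m) ^+ 2 - Q ^+ m) / q%:R.
  by apply: (mulfI q0); rewrite cntE ?rmorph1 // oner_eq0 !mul0r addr0 mulnC exprM mulrC divfK.
have hd m : Q ^+ m.*2.+1 = Q * (Q ^+ m) ^+ 2 by rewrite exprS -muln2 exprM.
have hq m : q%:R ^+ (2 * m + 2) = (Q ^+ m.+1) ^+ 2 :> C.
  by rewrite -[in RHS]exprM [in RHS]mulnC exprM sqrrN -exprM mulnS addnC.
elim: n => [|n [IH1 IH2]].
  split.
    rewrite charsum_rec charsum0 charsum1 /residue /defect !mulr0 !subr0 charsum0 charsum1.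
    rewrite cnt_dim0 c1 /= !expr1 expr0; field.
    exact: q0.
  rewrite charsum_rec /residue /defect charsum0 charsum1 !cnt_0_1 !c1 hq hd /= !expr1 expr0; field.
  exact: q0.
split=> //.
(* [charsum_rec] expresses [charsum n.+4] by the four preceding sums; the recursion for
   [charsum n.+2] reduces this to two terms. *)
rewrite charsum_rec /residue /defect !cnt_0_1 !c1 !hq hd IH1 hd.
rewrite !(exprS _ n.+2) !(exprS _ n.+1) !(exprS _ n).
move: (Q ^+ n) (charsum n) (charsum n.+1) (charsum n.+3) => X S0 S1 S3; field.
exact: q0.
Qed.

(** * Group orders and averaged sums *)

Lemma card_unitary0 : #|unitary 0| = 1%N.
Proof.
rewrite -(cards1 (1%:M : 'M[F]_0)); congr #|pred_of_set _|; apply/setP => g.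
by rewrite !inE (flatmx0 (adj g *m g)) (flatmx0 1%:M) (flatmx0 g) !eqxx.
Qed.

(** The group is transitive on unit vectors, with stabilizer U(n,q). *)
Lemma card_unitaryS n : #|unitary n.+1|%:R = cnt n.+1 1 * #|unitary n|%:R.
Proof.
rewrite -[n.+1]/(1 + n)%N -!sumr_const.
rewrite (partition_big (fun g => g *m evec n) (fun x => hdot x x == 1)) /=; last first.
  by move=> g gU; rewrite hdot_unitary ?hdot_evec.
rewrite /cnt big_distrl /=; apply: eq_bigr => x /eqP /exists_unitary_evec[R RU <-].
by rewrite sum_unitary_evec // mul1r.
Qed.

Lemma cntS1 n : cnt n.+1 1 = - (Q ^+ n * (Q ^+ n.+1 - 1)).
Proof.
apply: (mulfI q_neq0); rewrite cntE ?rmorph1 // oner_eq0 !mul0r addr0 mulnC exprM !(exprS _ n).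
by ring.
Qed.

Lemma Q_exp_neq1 n : Q ^+ n.+1 != 1.
Proof.
apply/negP => /eqP /(congr1 Num.norm); rewrite normrX normrN normr_nat normr1.
by move/eqP; rewrite -natrX pnatr_eq1 -(exp1n n.+1) eqn_exp2r // => /eqP h; move: q_gt1; rewrite h.
Qed.

Definition avg n := (#|unitary n|%:R)^-1 * charsum n.

Lemma card_unitary_neq0 n : (#|unitary n|%:R : C) != 0.
Proof. by rewrite pnatr_eq0 -lt0n; apply/card_gt0P; exists 1%:M; exact: unitary1. Qed.

Lemma avg0 : avg 0 = 1.
Proof. by rewrite /avg card_unitary0 charsum0 invr1 mulr1. Qed.

Lemma avg1 : (Q - 1) * avg 1 = - g1.
Proof.
have hY : Q - 1 != 0 by rewrite subr_eq0 -[Q]expr1 Q_exp_neq1.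
rewrite /avg card_unitaryS card_unitary0 charsum1 cntS1 expr0 expr1.
by move: Q hY => Y hY; field; rewrite hY.
Qed.

Lemma avg_rec n : (Q ^+ n.+2 - 1) * avg n.+2 = g2 * avg n - g1 * avg n.+1.
Proof.
have h2 : Q ^+ n.+2 - 1 != 0 by rewrite subr_eq0 Q_exp_neq1.
have h1 : Q ^+ n.+1 - 1 != 0 by rewrite subr_eq0 Q_exp_neq1.
have hX : Q ^+ n != 0 by rewrite expf_neq0 // Q_neq0.
have hq : Q ^+ n.*2.+1 = Q * (Q ^+ n) ^+ 2 by rewrite exprS -muln2 exprM.
have hU := card_unitary_neq0 n.
rewrite /avg !card_unitaryS charsum_three_term !cntS1 hq.
move: h2 h1 hX hU (Q_neq0); rewrite !(exprS _ n.+1) !(exprS _ n).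
move: (Q ^+ n) (charsum n) (charsum n.+1) (#|_|%:R : C) Q => X S0 S1 u Y h2 h1 hX hU hY.
by field; rewrite hU hX hY h1 h2.
Qed.

(** * The infinite product *)

Notation rfactor := (rhs_factor q chi lam).

(** The series E(u / Q^K), cut after degree N in order to stay among polynomials. *)
Definition trunc_avg N K : {poly C} := \poly_(n < N.+1) (avg n * (Q ^- K) ^+ n).

Lemma coef_rfactor_mul i (p : {poly C}) n : (rfactor i * p)`_n =
  p`_n - g1 / Q ^+ i * (if n is m.+1 then p`_m else 0) +
  g2 / Q ^+ i ^+ 2 * (if n is m.+2 then p`_m else 0).
Proof.
have h1 : (-1) ^+ i.+1 * g1 / q%:R ^+ i = - (g1 / Q ^+ i).
  by rewrite -[in RHS]mulN1r exprMn invfM exprS mulN1r !mulNr -signr_odd invr_sign; ring.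
have h2 : q%:R ^+ (2 * i) = (Q ^+ i) ^+ 2 by rewrite exprAC sqrrN exprM.
rewrite /rhs_factor h1 h2 !mulrDl mul1r -(scalerAl _ 'X) -(scalerAl _ 'X^2).
rewrite !coefD !coefZ coefXM coefXnM mulNr.
by case: n => [|[|n]] //=; rewrite subn2.
Qed.

(** The functional equation with u replaced by u / Q^(K+1); truncation does not affect degrees up to
    N. Degree 1 rests on [avg1] and higher degrees on [avg_rec]. *)
Lemma rfactor_trunc_avg N K n : (n <= N)%N ->
  (rfactor K.+1 * trunc_avg N K.+1)`_n = (trunc_avg N K)`_n.
Proof.
move=> hn; rewrite coef_rfactor_mul /trunc_avg !coef_poly ltnS hn.
have hQ : Q ^+ K != 0 by rewrite expf_neq0 // Q_neq0.
have Q0 := Q_neq0.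
case: n hn => [|[|n]] hn.
- by rewrite !expr0 !mulr0 subr0 addr0.
- rewrite coef_poly /= !expr1 avg0 expr0 mulr0 addr0 exprS; have := avg1.
  move: (avg 1) Q Q0 hQ => a Y hY hX h.
  have -> : g1 = - ((Y - 1) * a) by rewrite h opprK.
  by field; rewrite hX hY.
rewrite !coef_poly !ltnS (ltnW hn) (ltnW (ltnW hn)).
have := avg_rec n; rewrite (exprS _ K) !exprVn !exprMn.
have hQn : Q ^+ n != 0 by rewrite expf_neq0.
have hQKn : (Q ^+ K) ^+ n != 0 by rewrite expf_neq0.
rewrite !(exprS _ n.+1) !(exprS _ n).
move: (avg n) (avg n.+1) (avg n.+2) Q Q0 hQ hQn hQKn => a a1 a2 Y hY hX hV hU h.
apply/eqP; rewrite -subr_eq0; apply/eqP.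
transitivity (((g2 * a - g1 * a1) - (Y * (Y * Y ^+ n) - 1) * a2) /
  ((Y ^+ K) ^+ 2 * Y ^+ 2 * (Y ^+ K) ^+ n * Y ^+ n)).
  by field; rewrite hU hV hX hY.
by rewrite h subrr mul0r.
Qed.

(** Iterating the functional equation, E(u) is the product of the first K factors times E(u / Q^K);
    this is its coefficient of degree N. *)
Lemma avg_partial_prod N K :
  avg N = \sum_(j < N.+1) (\prod_(1 <= i < K.+1) rfactor i)`_j * (avg (N - j) * (Q ^- K) ^+ (N - j)).
Proof.
transitivity ((\prod_(1 <= i < K.+1) rfactor i * trunc_avg N K)`_N); last first.
  by rewrite coefM; apply: eq_bigr => j _; rewrite coef_poly ltnS leq_subr.
elim: K => [|K IH].
  by rewrite big_geq // mul1r coef_poly ltnSn expr0 invr1 expr1n mulr1.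
rewrite IH [in RHS]big_nat_recr //= -mulrA !coefM; apply: eq_bigr => j _.
by rewrite rfactor_trunc_avg // leq_subr.
Qed.

Lemma unitary_groupE n : unitary n = unitary_group F q n.
Proof.
apply/setP => g; rewrite !inE /adj.
by congr (_^T *m _ == _); apply: eq_map_mx => x; rewrite barE.
Qed.

Lemma lhs_coeffE n : lhs_coeff q chi lam n = avg n.
Proof.
case: n => [|n]; first by rewrite avg0.
rewrite /avg unitary_groupE; congr (_ * _); rewrite /charsum /Phi unitary_groupE.
by apply: eq_bigr => g _; rewrite mul1mx.
Qed.

End QuadraticExtension.

(** * Convergence of coefficients from a convolution identity *)

Section ConvolutionLimit.
Local Open Scope classical_set_scope.

Lemma cvg_exp_complex (R : realType) (z : R) : `|z| < 1 ->
  ((fun K => (z%:C%C) ^+ K) : nat -> R[i]^o) @ \oo --> (0 : R[i]^o).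
Proof.
move=> hz; apply/cvgr0Pnorm_lt => -[e i] /=; rewrite ltcE /= => /andP[/eqP -> e0].
have /cvgr0Pnorm_lt /(_ e e0) := cvg_expr hz; apply: filterS => K hK.
rewrite -[Complex e 0]/(e%:C%C) -rmorphXn normc_def /= expr0n addr0 sqrtr_sqr.
by rewrite ltcR.
Qed.

(** Strong induction on N: the term j = N is [P K N] because [a 0 = 1], and every other term is a
    convergent sequence times a power of z tending to 0. *)
Lemma cvg_coef_of_convolution (R : realType) (P : nat -> nat -> R[i]) (a : nat -> R[i]) (z : R) :
  `|z| < 1 -> a 0 = 1 ->
  (forall N K, a N = \sum_(j < N.+1) P K j * (a (N - j)%N * ((z%:C%C) ^+ K) ^+ (N - j))) ->
  forall N, ((fun K => P K N) : nat -> R[i]^o) @ \oo --> (a N : R[i]^o).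
Proof.
move=> hz a0 ha; elim/ltn_ind => N IH.
have -> : ((fun K => P K N) : nat -> R[i]^o) = (fun K => a N - 
    \sum_(j < N) P K j * (a (N - j)%N * ((z%:C%C) ^+ K) ^+ (N - j))).
  apply/funext => K; rewrite {1}(ha N K) big_ord_recr /= subnn a0 expr0 !mulr1.
  by rewrite addrAC subrr add0r.
rewrite -[X in _ --> X]subr0; apply: cvgB; first exact: cvg_cst.
rewrite -[X in _ --> X](@big1 R[i] 0 +%R _ (index_enum 'I_N) xpredT (fun=> 0)) //.
apply: (@cvg_big R[i]^o 'I_N +%R 0 xpredT _ nat \oo (index_enum 'I_N)
  (fun (j : 'I_N) (K : nat) => (P K j * (a (N - j)%N * ((z%:C%C) ^+ K) ^+ (N - j)) : R[i]^o))
  (fun=> 0)) => [|j _]; first exact: add_continuous.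
have hw : `|z ^+ (N - j)| < 1.
  by rewrite normrX exprn_ilt1 // ?normr_ge0 // subn_eq0 -ltnNge.
have -> : (fun K => P K j * (a (N - j)%N * (z%:C%C ^+ K) ^+ (N - j))) =
   (fun K => P K j * (a (N - j)%N * ((z ^+ (N - j))%:C%C) ^+ K)).
  by apply/funext => K; rewrite exprAC -rmorphXn.
rewrite -[X in _ --> X](mulr0 (a j)) -[X in a j * X](mulr0 (a (N - j)%N)).
apply: cvgM; first exact: IH.
by apply: cvgM; [exact: cvg_cst | exact: cvg_exp_complex].
Qed.

End ConvolutionLimit.

Unset Implicit Arguments. Set Strict Implicit. Set Printing Implicit Defensive.

Local Open Scope classical_set_scope.

(* The infinite product is a formal power series whose u^N coefficient is the
   limit (K -> oo) of the u^N coefficient of the partial product over 1 <= i <= K. *)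
Theorem theorem3 (R : realType) (F : finFieldType) (q : nat)
  (hq : prime_power q) (hF : #|F| = (q ^ 2)%N)
  (chi lam : F -> R[i])
  (hchi : mult_char chi) (hlam : add_char lam) (hnt : exists x, lam x != 1)
  (N : nat) :
  ((fun K : nat => (\prod_(1 <= i < K.+1) rhs_factor q chi lam i)`_N)
     : nat -> R[i]^o) @ \oo --> (lhs_coeff q chi lam N : R[i]^o).
Proof.
have [p [k [p_pr k_gt0 qE]]] := hq.
have q_gt1 : (1 < q)%N by rewrite qE -(exp1n k) ltn_exp2r // prime_gt1.
(* Additivity holds because q is a power of the characteristic of F. *)
have qconjB : zmod_morphism (@qconj F q).
  have hp : p \in [pchar F] by apply: (@card_finPcharP F p (k * 2)); rewrite // expnM -qE.
  have hqp : [pchar F].-nat q by rewrite qE pnatX pnatE // hp.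
  by move=> x y; rewrite /qconj exprDn_pchar // exprNn_pchar.
have qconjM : monoid_morphism (@qconj F q).
  by split=> [|x y]; rewrite /qconj ?expr1n ?exprMn.
pose bar : {rmorphism F -> F} := HB.pack (@qconj F q)
  (GRing.isZmodMorphism.Build F F _ qconjB) (GRing.isMonoidMorphism.Build F F _ qconjM).
have barE x : bar x = x ^+ q by [].
have [chi0 chi1 chiM] := hchi; have [lam0 lamD] := hlam.
have [s0 s0_neq0 hs0] := exists_trace0_annihilator q_gt1 hF barE lam0 lamD hnt.
have q0 : (0 : R) < q%:R by rewrite ltr0n ltnW.
have hz : `|(- q%:R)^-1 : R| < 1.
  by rewrite normfV normrN normr_nat invf_lt1 // ltr1n.
have := @cvg_coef_of_convolution R
  (fun K n => (\prod_(1 <= i < K.+1) rhs_factor q chi lam i)`_n) (lhs_coeff q chi lam)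
  (- q%:R)^-1 hz erefl; apply => n K.
have hE m : lhs_coeff q chi lam m = avg bar chi lam m by apply: lhs_coeffE.
rewrite hE (@avg_partial_prod F q bar _ _ _ _ chi lam _ _ _ _ _ _ s0 _ _ n K) //.
apply: eq_bigr => j _; rewrite hE; congr (_ * (_ * _ ^+ _)).
by rewrite -exprVn fmorphV rmorphN rmorph_nat.
Qed.
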